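(* Let $R$ be the endomorphism ring of an elliptic curve. Any finite subgroup $K$ of $SL(2,R)$ is isomorphic to one of the following: $$K_1=\{I_2\},$$ $$K_2=\langle -I_2\rangle\simeq C_2,$$ $$K_3=\langle g_1\rangle\simeq C_4\ \text{ for some } g_1\in SL(2,R) \text{ with } \mathrm{tr}(g_1)=0,$$ $$K_4=\langle g_1,g_2 \mid g_1^2=g_2^2=-I_2,\ g_2g_1g_2=g_1\rangle\simeq\mathbb{Q}_8,$$ $$K_5=\langle g_3\rangle\simeq C_3\ \text{ for some } g_3\in SL(2,R)\text{ with }\mathrm{tr}(g_3)=-1,$$ $$K_6=\langle g_4\rangle\simeq C_6\ \text{ for some } g_4\in SL(2,R)\text{ with }\mathrm{tr}(g_4)=1,$$ $$K_7=\langle g_1,g_4\mid g_1^2=g_4^3=-I_2,\ g_4g_1g_4=g_1\rangle\simeq\mathbb{Q}_{12}$$ for some $g_1,g_4\in SL(2,R)$ with $\mathrm{tr}(g_1)=0$, $\mathrm{tr}(g_4)=1$, $$K_8=\langle g_1,g_2,g_3\mid g_1^2=g_2^2=-I_2,\ g_3^3=I_2,\ g_2g_1=-g_1g_2,\ g_3g_1g_3^{-1}=g_2,\ g_3g_2g_3^{-1}=g_1g_2\rangle\simeq SL(2,\mathbb{F}_3)$$ for some $g_1,g_2,g_3\in SL(2,R)$ with $\mathrm{tr}(g_1)=\mathrm{tr}(g_2)=0$, $\mathrm{tr}(g_3)=-1$.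
   Context: $R=\mathrm{End}(E)$ for a complex elliptic curve $E$; thus $R=\mathbb{Z}$ or $R=\mathbb{Z}+f\mathcal{O}_{-d}\subset\mathbb{C}$ for some $f\in\mathbb{N}$ and the integers ring $\mathcal{O}_{-d}$ of an imaginary quadratic number field. $SL(2,R)=\{g\in R_{2\times 2}:\det(g)=1\}$. $C_n$ is the cyclic group of order $n$, $\mathbb{Q}_8$ is the quaternion group of order $8$, $\mathbb{Q}_{12}$ is the dicyclic group of order $12$, and $SL(2,\mathbb{F}_3)$ is the special linear group over the field with three elements. *)

(* Defs.v *)
From HB Require Import structures.
From mathcomp Require Import all_boot all_order all_algebra all_fingroup.
From mathcomp Require Import all_solvable.
From mathcomp Require Import complex.
From mathcomp Require Import all_classical all_reals all_analysis.

Set Implicit Arguments.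
Unset Strict Implicit.
Unset Printing Implicit Defensive.

Import Order.TTheory GRing.Theory Num.Theory.
Import numFieldNormedType.Exports.

Local Open Scope classical_set_scope.
Local Open Scope ring_scope.

Section EllipticCurve.
Variable T : realType.
Local Notation C := (T[i]).

Definition is_lattice (L : set C) : Prop :=
  exists w1 w2 : C,
    (forall a b : T, a%:C%C * w1 + b%:C%C * w2 = 0 -> a = 0 /\ b = 0) /\
    L = [set z | exists m n : int, z = m%:~R * w1 + n%:~R * w2].

(* Elliptic curves are complex tori C/L.  A holomorphic endomorphism of the
   group C/L lifts to the universal cover as an entire function F that is
   compatible with congruence modulo L and additive modulo L. *)
Definition lifts_endomorphism (L : set C) (F : C^o -> C^o) : Prop :=
  [/\ forall z : C^o, derivable F z 1,
      forall z w : C, L (z - w) -> L (F z - F w)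
    & forall z w : C, L (F (z + w) - (F z + F w))].

(* End(C/L) as a subring of C: an endomorphism is identified with its
   differential at the origin, i.e. with the derivative of its lifts at 0. *)
Definition endomorphism_ring (L : set C) : set C :=
  [set a | exists F : C^o -> C^o,
     lifts_endomorphism L F /\ is_derive (0 : C^o) 1 F a].

End EllipticCurve.

Section SL2.
Variable A : comNzRingType.

Record SL2 : Type := MkSL2 { SL2_mx :> 'M[A]_2 ; _ : \det SL2_mx == 1 }.

HB.instance Definition _ := [isSub for SL2_mx].
HB.instance Definition _ := [Choice of SL2 by <:].

Lemma SL2_mul_subproof (g h : SL2) : \det (val g *m val h) == 1.
Proof. by rewrite det_mulmx (eqP (valP g)) (eqP (valP h)) mulr1. Qed.

Lemma SL2_one_subproof : \det (1%:M : 'M[A]_2) == 1.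
Proof. by rewrite det1. Qed.

Lemma SL2_inv_subproof (g : SL2) : \det (\adj (val g)) == 1.
Proof.
have /(congr1 determinant) := mul_mx_adj (val g).
by rewrite det_mulmx (eqP (valP g)) mul1r det1 => ->.
Qed.

Definition SL2_mul (g h : SL2) : SL2 := MkSL2 (SL2_mul_subproof g h).
Definition SL2_one : SL2 := MkSL2 SL2_one_subproof.
Definition SL2_inv (g : SL2) : SL2 := MkSL2 (SL2_inv_subproof g).

Lemma SL2_mulA : associative SL2_mul.
Proof. by move=> x y z; apply/val_inj; rewrite /= mulmxA. Qed.

Lemma SL2_mul1 : left_id SL2_one SL2_mul.
Proof. by move=> x; apply/val_inj; rewrite /= mul1mx. Qed.

Lemma SL2_mulr1 : right_id SL2_one SL2_mul.
Proof. by move=> x; apply/val_inj; rewrite /= mulmx1. Qed.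

Lemma SL2_mulV : left_inverse SL2_one SL2_inv SL2_mul.
Proof.
by move=> x; apply/val_inj; rewrite /= mul_adj_mx (eqP (valP x)).
Qed.

Lemma SL2_mulrV : right_inverse SL2_one SL2_inv SL2_mul.
Proof.
by move=> x; apply/val_inj; rewrite /= mul_mx_adj (eqP (valP x)).
Qed.

HB.instance Definition _ := isGroup.Build SL2
  SL2_mulA SL2_mul1 SL2_mulr1 SL2_mulV SL2_mulrV.

Lemma SL2_opp1_subproof : \det (- 1%:M : 'M[A]_2) == 1.
Proof. by rewrite -scaleN1r detZ det1 mulr1 sqrrN expr1n. Qed.

Definition SL2_opp1 : SL2 := MkSL2 SL2_opp1_subproof.

Definition SL2_over (S : set A) : set SL2 :=
  [set g | forall i j, S (g i j)].

End SL2.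

Section Groups.
Local Open Scope group_scope.

Definition is_subgroup (G : groupType) (K : set G) : Prop :=
  group_closed [in K].

Definition subgroup_generated (G : groupType) (X : set G) : set G :=
  smallest (@is_subgroup G) X.

Definition isomorphic (G H : groupType) (A : set G) (B : set H) : Prop :=
  exists f : G -> H,
    {in A &, {morph f : x y / x * y}} /\ set_bij A B f.

(* [s] satisfies the relations [P], and every relation between its entries
   follows from [P] (von Dyck's universal property). *)
Definition presented (P : forall H : groupType, seq H -> Prop)
    (G : groupType) (s : seq G) : Prop :=
  P G s /\
  forall (H : groupType) (t : seq H), P H t ->
    exists f : G -> H,
      {in subgroup_generated [set` s] &, {morph f : x y / x * y}} /\ map f s = t.

(* In the three sets of relations below the first entry [z] plays the role of
   -I_2; each set makes it a word in the other entries, so it is the name of an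
   element of the presented group rather than an additional generator. *)
Definition Q8_relations (H : groupType) (s : seq H) : Prop :=
  if s is [:: z; x1; x2] then
    [/\ x1 ^+ 2 = z, x2 ^+ 2 = z & x2 * x1 * x2 = x1]
  else False.

Definition Q12_relations (H : groupType) (s : seq H) : Prop :=
  if s is [:: z; x1; x4] then
    [/\ x1 ^+ 2 = z, x4 ^+ 3 = z & x4 * x1 * x4 = x1]
  else False.

Definition SL2F3_relations (H : groupType) (s : seq H) : Prop :=
  if s is [:: z; x1; x2; x3] then
    [/\ x1 ^+ 2 = z /\ x2 ^+ 2 = z, x3 ^+ 3 = 1, x2 * x1 = z * (x1 * x2),
        x3 * x1 * x3^-1 = x2 & x3 * x2 * x3^-1 = x1 * x2]
  else False.

(* Presentation of the dicyclic group of order 4n (the library's 'Q_m is only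
   meaningful when m is a power of 2). *)
Definition dicyclic (n : nat) (gT : finGroupType) (G : {group gT}) : Prop :=
  G \isog Grp (a : b : (a ^+ n.*2, b ^+ 2 = a ^+ n, a ^ b = a^-1)).

End Groups.

(* Main.v *)
From HB Require Import structures.
Require Import Defs.
From mathcomp Require Import all_boot all_order all_algebra all_fingroup.
From mathcomp Require Import all_solvable.
From mathcomp Require Import complex.
From mathcomp Require Import all_classical all_reals all_analysis.
From mathcomp Require Import finmap zify.
Set Implicit Arguments.
Unset Strict Implicit.
Unset Printing Implicit Defensive.
Import Order.TTheory GRing.Theory Num.Theory.

Local Open Scope classical_set_scope.
Local Open Scope group_scope.
Bind Scope group_scope with Group.sort.

(** Two facts make the group K so small: its traces are integers between -2
    and 2, and the values 2 and -2 are taken at I and -I only.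

    If F lifts an endomorphism of C/L, then F(z + w) - F(z) - F(w) is a
    continuous function of z with values in the discrete set L, hence it is
    constant and F - F(0) is additive.  An additive map with derivative a at 0
    is multiplication by a, so a L is contained in L
    ([endomorphism_ring_mulL]).  A real number a with this property is an
    integer, as one sees on the coordinates of a w1
    ([real_lattice_multiplier]).  An element g of K has finite order, so its
    eigenvalues are conjugate roots of unity: tr g is real, hence an integer,
    and |tr g| <= 2; moreover tr g = 2 makes g unipotent of finite order,
    which is the identity ([finite_subgroup_integral_trace]).

    Matrices can now be forgotten.  Let t be the trace on K; the
    Cayley-Hamilton identity h + h^-1 = tr h gives
    t(gh) + t(gh^-1) = t(g) t(h).  For the inner product t(gh^-1)/2 the elements
    of K are unit vectors, at most four of them independent, at angles
    which are multiples of 60 or of 90 degrees; when -I is in K they form a root system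
    A1, 2A1, 4A1, A2, 2A2 or D4, and these are the groups C2, C4, Q8, C6, Q12
    and SL(2, 3).  When -I is not in K only C1 and C3 remain.
    [integral_trace_classification] proves this by elementary manipulations of
    the functional equation of t.

    It remains to recognize the groups.  Each of them consists of normal forms
    such as a^i b^j, whose product is computed from the defining relations
    alone.  Hence, if these relations hold in two groups G and H, the pairs of
    corresponding normal forms are a subgroup of G x H.  It is the graph of a
    morphism as soon as a normal form which is trivial in G is trivial in H
    ([graph_morphism]), and the graph of an isomorphism if the converse holds
    too.  The first statement yields the universal property of the
    presentations, the second one the isomorphisms with the standard
    groups. *)

(** * Generated subgroups and graphs of morphisms *)

Section Subgroups.
Variables (G : groupType) (K : set G).
Hypothesis Ksub : is_subgroup K.

Lemma subgroup1 : K 1.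
Proof. by case: Ksub => /set_mem. Qed.

Lemma subgroupV x : K x -> K x^-1.
Proof. by move=> /mem_set Kx; apply/set_mem/(group_closedV Ksub). Qed.

Lemma subgroupM x y : K x -> K y -> K (x * y).
Proof.
by move=> /mem_set Kx /mem_set Ky; apply/set_mem/(group_closedM Ksub).
Qed.

Lemma subgroupX x n : K x -> K (x ^+ n).
Proof.
move=> Kx; elim: n => [|n IHn]; first by rewrite expg0; exact: subgroup1.
by rewrite expgS; exact: subgroupM.
Qed.

End Subgroups.

Lemma is_subgroupP (G : groupType) (K : set G) :
  K 1 -> (forall x y, K x -> K y -> K (x * y)) -> (forall x, K x -> K x^-1) ->
  is_subgroup K.
Proof.
move=> K1 KM KV; split; first exact: mem_set.
move=> x y /set_mem Kx /set_mem Ky; apply/mem_set/KM => //; exact: KV.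
Qed.

Lemma subgroup_generated_subgroup (G : groupType) (X : set G) :
  is_subgroup (subgroup_generated X).
Proof.
apply: is_subgroupP.
- by move=> S [Ssub _]; exact: subgroup1.
- move=> x y Gx Gy S SX; have [Ssub _] := SX.
  by apply: subgroupM => //; [exact: Gx|exact: Gy].
- move=> x Gx S SX; have [Ssub _] := SX.
  by apply: subgroupV => //; exact: Gx.
Qed.

Lemma subset_subgroup_generated (G : groupType) (X : set G) :
  X `<=` subgroup_generated X.
Proof. exact: sub_smallest. Qed.

Lemma subgroup_generated_min (G : groupType) (X K : set G) :
  is_subgroup K -> X `<=` K -> subgroup_generated X `<=` K.
Proof. by move=> Ksub XK; apply: smallest_sub. Qed.

(** The y such that S is stable under left multiplication by y and by y^-1 form
    a subgroup.  It contains X because the inverse of an element of finite order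
    is one of its positive powers. *)
Lemma subgroup_generated_left_mul (G : groupType) (X S : set G) :
  S 1 -> (forall x s, X x -> S s -> S (x * s)) ->
  (forall x, X x -> exists m, x ^+ m.+1 = 1) ->
  S `<=` subgroup_generated X -> subgroup_generated X = S.
Proof.
move=> S1 XS Xfin SX; apply/seteqP; split=> // y Gy.
pose Y := [set y : G | forall s, S s -> S (y * s) /\ S (y^-1 * s)].
have Ysub : is_subgroup Y.
  apply: is_subgroupP.
  - by move=> s Ss; rewrite invg1 mul1g.
  - move=> u v Yu Yv s Ss; rewrite invgM -!mulgA; split.
      by have [Svs _] := Yv _ Ss; have [] := Yu _ Svs.
    by have [_ Sus] := Yu _ Ss; have [] := Yv _ Sus.
  - by move=> u Yu s /Yu; rewrite invgK => -[].
have XY : X `<=` Y.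
  move=> x Xx s Ss; split; first exact: XS.
  have [m xm] := Xfin x Xx.
  have -> : x^-1 = x ^+ m.
    by apply: (mulgI x); rewrite mulgV -expgS xm.
  elim: m {xm} => [|m IHm]; first by rewrite expg0 mul1g.
  by rewrite expgS -mulgA; apply: XS.
have [Sy _] := subgroup_generated_min Ysub XY Gy _ S1.
by rewrite mulg1 in Sy.
Qed.

Section Graph.
Variables (I : Type) (G H : groupType) (N : I -> G) (M : I -> H).
Hypothesis NM_sub : is_subgroup (range (fun i => (N i, M i) : (G * H)%type)).
Hypothesis N1M1 : forall i, N i = 1 -> M i = 1.

Let NM_inj i j : N i = N j -> M i = M j.
Proof.
move=> eqN.
have NMi : range (fun i => (N i, M i) : (G * H)%type) (N i, M i) by exists i.
have NMj : range (fun i => (N i, M i) : (G * H)%type) (N j, M j) by exists j.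
have [k _ [Nk Mk]] := subgroupM NM_sub NMi (subgroupV NM_sub NMj).
apply/eqP; rewrite -(can_eq (mulgK (M j)^-1)) mulgV; apply/eqP.
by rewrite -[LHS]Mk; apply: N1M1; rewrite Nk -eqN mulgV.
Qed.

(** If N i = N j, the quotient of the pairs of indices i and j is a pair of index
    k with N k = 1; then M k = 1, that is M i = M j.  So the set of pairs is the
    graph of a map, which is multiplicative because this set is closed under
    products. *)
Lemma graph_morphism : exists f : G -> H,
  {in range N &, {morph f : x y / x * y}} /\ forall i, f (N i) = M i.
Proof.
have [f fE] : exists f : G -> H, forall i, f (N i) = M i.
  have /choice [f fE] : forall x, exists y, forall i, N i = x -> y = M i.
    move=> x; have [[i <-]|nx] := pselect (exists i, N i = x).
      by exists (M i) => j /esym; exact: NM_inj.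
    by exists 1 => i Ni; case: nx; exists i.
  by exists f => i; exact: fE.
exists f; split=> // _ _ /set_mem[i _ <-] /set_mem[j _ <-].
have NMi : range (fun i => (N i, M i) : (G * H)%type) (N i, M i) by exists i.
have NMj : range (fun i => (N i, M i) : (G * H)%type) (N j, M j) by exists j.
have [k _ [Nk Mk]] := subgroupM NM_sub NMi NMj.
by rewrite -[N i * N j]Nk !fE Mk.
Qed.

End Graph.

Lemma graph_isomorphic (I : Type) (G H : groupType) (N : I -> G) (M : I -> H) :
  is_subgroup (range (fun i => (N i, M i) : (G * H)%type)) ->
  (forall i, N i = 1 <-> M i = 1) -> isomorphic (range N) (range M).
Proof.
move=> NM_sub N1M1.
have [f [fM fE]] := graph_morphism NM_sub (fun i => (N1M1 i).1).
exists f; split=> //; split.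
- by move=> _ [i _ <-]; rewrite /= fE; exists i.
- move=> _ _ /set_mem[i _ <-] /set_mem[j _ <-]; rewrite !fE => eqM.
  have NMi : range (fun i => (N i, M i) : (G * H)%type) (N i, M i) by exists i.
  have NMj : range (fun i => (N i, M i) : (G * H)%type) (N j, M j) by exists j.
  have [k _ [Nk Mk]] := subgroupM NM_sub NMi (subgroupV NM_sub NMj).
  apply/eqP; rewrite -(can_eq (mulgK (N j)^-1)) mulgV; apply/eqP.
  by rewrite -[LHS]Nk; apply/N1M1; rewrite Mk eqM mulgV.
- by move=> _ [i _ <-]; exists (N i); [exists i|rewrite fE].
Qed.

Lemma expg_pair (G H : groupType) (x : G) (y : H) n :
  ((x, y) : (G * H)%type) ^+ n = (x ^+ n, y ^+ n).
Proof. by elim: n => [|n IHn]; rewrite ?expg0 // !expgS IHn. Qed.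

(** * Cyclic groups *)

Definition has_order (G : groupType) (x : G) (n : nat) :=
  forall i, x ^+ i = 1 <-> (n %| i)%N.

Lemma has_orderP (G : groupType) (x : G) n : (0 < n)%N -> x ^+ n = 1 ->
  (forall i, (0 < i < n)%N -> x ^+ i <> 1) -> has_order x n.
Proof.
move=> n_gt0 xn xi i; split=> [xi1|/dvdnP[k ->]]; last first.
  by rewrite mulnC expgM xn expg1n.
have : x ^+ (i %% n)%N = 1.
  by move: xi1; rewrite {1}(divn_eq i n) expgD mulnC expgM xn expg1n mul1g.
rewrite /dvdn => xr; case: (posnP (i %% n)%N) => [//|r_gt0].
by have := xi (i %% n)%N; rewrite r_gt0 ltn_pmod // => /(_ isT).
Qed.

Lemma subgroup_generated1 (G : groupType) (x : G) n : x ^+ n.+1 = 1 ->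
  subgroup_generated [set x] = range (fun i : nat => x ^+ i).
Proof.
move=> xn; apply: subgroup_generated_left_mul.
- by exists 0%N; rewrite ?expg0.
- by move=> _ _ -> [i _ <-]; exists i.+1; rewrite ?expgS.
- by move=> _ ->; exists n.
- move=> _ [i _ <-]; apply: (subgroupX (subgroup_generated_subgroup _)).
  exact: subset_subgroup_generated.
Qed.

Lemma cyclic_isomorphic (G H : groupType) (x : G) (y : H) n :
  has_order x n.+1 -> has_order y n.+1 ->
  isomorphic (range (fun i : nat => x ^+ i)) (range (fun i : nat => y ^+ i)).
Proof.
move=> ox oy; apply: graph_isomorphic => [|i]; last first.
  by rewrite (ox i) (oy i).
have xyn : ((x, y) : (G * H)%type) ^+ n.+1 = 1.
  by rewrite expg_pair ((ox _).2 _) // ((oy _).2 _).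
rewrite (_ : (fun i => _) = (fun i => ((x, y) : (G * H)%type) ^+ i)).
  by rewrite -(subgroup_generated1 xyn); exact: subgroup_generated_subgroup.
by apply/funext => i; rewrite expg_pair.
Qed.

(** * Dicyclic groups *)

(** Relations of the dicyclic group of order 4n, which is the quaternion group
    for n = 2.  There is no relation on the order of a: it is a consequence
    ([dicyclic_a2n]). *)
Definition dicyclic_rel (n : nat) (G : groupType) (a b : G) :=
  b ^+ 2 = a ^+ n /\ a * b * a = b.

Definition dicyclic_nf (G : groupType) (a b : G) (ij : nat * nat) : G :=
  a ^+ ij.1 * b ^+ ij.2.

Section Relations.
Variables (n : nat) (G : groupType) (a b : G).
Hypothesis ab_rel : dicyclic_rel n a b.

Lemma dicyclic_bX i : b * a ^+ i = a ^- i * b.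
Proof.
have [_ aba] := ab_rel; apply: (mulgI (a ^+ i)); rewrite mulKVg.
elim: i => [|i IHi]; first by rewrite expg0 mulg1 mul1g.
by rewrite {1}expgS expgSr -!mulgA (mulgA b) (mulgA (a ^+ i)) IHi mulgA.
Qed.

(** Conjugation by b inverts a, hence a^n = b^2; it also fixes b^2. *)
Lemma dicyclic_b4 : b ^+ 4 = 1.
Proof.
have [b2 _] := ab_rel; have := dicyclic_bX n.
rewrite -b2 -expgS => /(congr1 (mulg (b ^+ 2))).
rewrite mulKVg -expgD => b5.
by apply: (mulgI b); rewrite mulg1 -expgS.
Qed.

Lemma dicyclic_a2n : a ^+ n.*2 = 1.
Proof.
by have [b2 _] := ab_rel; rewrite -muln2 expgM -b2 -expgM dicyclic_b4.
Qed.

Lemma dicyclic_generated : (0 < n)%N ->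
  subgroup_generated [set a; b] = range (dicyclic_nf a b).
Proof.
move=> n_gt0.
have a2n : a ^+ n.*2.-1.+1 = 1 by rewrite prednK ?double_gt0 ?dicyclic_a2n.
apply: subgroup_generated_left_mul.
- by exists (0, 0)%N => //; rewrite /dicyclic_nf !expg0 mulg1.
- move=> _ _ [->|->] [[i j] _ <-]; rewrite /dicyclic_nf /=.
    by exists (i.+1, j) => //=; rewrite expgS mulgA.
  exists (n.*2.-1 * i, j.+1)%N => //=; rewrite mulgA dicyclic_bX expgS mulgA.
  congr (_ * _ * _); apply: (mulgI (a ^+ i)).
  by rewrite mulgV -expgD -mulSn expgM a2n expg1n.
- by move=> _ [->|->]; [exists n.*2.-1|exists 3%N; exact: dicyclic_b4].
- have gen_sub := subgroup_generated_subgroup [set a; b].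
  move=> _ [[i j] _ <-]; apply: (subgroupM gen_sub).
    by apply: (subgroupX gen_sub); apply: subset_subgroup_generated; left.
  by apply: (subgroupX gen_sub); apply: subset_subgroup_generated; right.
Qed.

Lemma dicyclic_nfE i j :
  dicyclic_nf a b (i, j) = a ^+ (i + n * j./2) * b ^+ odd j.
Proof.
have [b2 _] := ab_rel.
rewrite /dicyclic_nf /= -[in LHS](odd_double_half j) addnC -mul2n expgD.
by rewrite [b ^+ (2 * _)]expgM b2 -expgM expgD mulgA.
Qed.

Lemma dicyclic_nf_eq1 i j :
  ~~ odd j -> (n.*2 %| i + n * j./2)%N -> dicyclic_nf a b (i, j) = 1.
Proof.
rewrite dicyclic_nfE => /negbTE-> /dvdnP[k ->].
by rewrite mulnC expgM dicyclic_a2n expg1n expg0 mulg1.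
Qed.

(** If j is odd, a trivial normal form makes b a power of a; then a and b commute
    and a b a = b reads a^2 = 1, which the order 2n > 2 of a excludes. *)
Lemma dicyclic_nf_faithful i j : (1 < n)%N -> has_order a n.*2 ->
  dicyclic_nf a b (i, j) = 1 -> ~~ odd j /\ (n.*2 %| i + n * j./2)%N.
Proof.
have [b2 aba] := ab_rel; move=> n_gt1 oa; rewrite dicyclic_nfE.
have [jodd|jeven] := boolP (odd j); last by rewrite expg0 mulg1 => /oa.
rewrite expg1 => aib.
have ab : a * b = b * a.
  apply: (mulgI (a ^+ (i + n * j./2))).
  by rewrite !mulgA aib -expgSr expgS -mulgA aib mulg1 mul1g.
have /oa : a ^+ 2 = 1.
  by apply: (mulIg b); rewrite mul1g -[RHS]aba -[RHS]mulgA -ab mulgA expgS expg1.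
move/dvdn_leq => /(_ isT).
by rewrite -muln2 leqNgt (leq_ltn_trans (_ : 2 <= 1 * 2)%N) // ltn_mul2r.
Qed.

End Relations.

Lemma dicyclic_rel_pair n (G H : groupType) (a b : G) (c d : H) :
  dicyclic_rel n a b -> dicyclic_rel n c d ->
  dicyclic_rel n ((a, c) : (G * H)%type) ((b, d) : (G * H)%type).
Proof.
move=> [b2 aba] [d2 cdc]; split; last by congr pair.
by rewrite !expg_pair b2 d2.
Qed.

Lemma dicyclic_pair_subgroup n (G H : groupType) (a b : G) (c d : H) :
  (0 < n)%N -> dicyclic_rel n a b -> dicyclic_rel n c d ->
  is_subgroup (range (fun ij => (dicyclic_nf a b ij, dicyclic_nf c d ij)
                                  : (G * H)%type)).
Proof.
move=> n_gt0 ab_rel cd_rel.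
have r := dicyclic_rel_pair ab_rel cd_rel.
rewrite (_ : (fun ij => _) =
             dicyclic_nf ((a, c) : (G * H)%type) ((b, d) : (G * H)%type)).
  by rewrite -(dicyclic_generated r n_gt0); exact: subgroup_generated_subgroup.
by apply/funext => ij; rewrite /dicyclic_nf !expg_pair.
Qed.

(** Von Dyck's theorem: the relations present every group where they hold and a
    has its full order 2n. *)
Lemma dicyclic_morphism n (G H : groupType) (a b : G) (c d : H) :
  (1 < n)%N -> dicyclic_rel n a b -> has_order a n.*2 -> dicyclic_rel n c d ->
  exists f : G -> H,
    [/\ {in subgroup_generated [set a; b] &, {morph f : x y / x * y}},
        f a = c & f b = d].
Proof.
move=> n_gt1 ab_rel oa cd_rel; have n_gt0 := ltnW n_gt1.
have [|f [fM fE]] :=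
    graph_morphism (dicyclic_pair_subgroup n_gt0 ab_rel cd_rel).
  move=> [i j] /(dicyclic_nf_faithful ab_rel n_gt1 oa)[].
  exact: dicyclic_nf_eq1.
exists f; rewrite (dicyclic_generated ab_rel n_gt0); split=> //.
  by have := fE (1, 0)%N; rewrite /dicyclic_nf /= !expg1 !expg0 !mulg1.
by have := fE (0, 1)%N; rewrite /dicyclic_nf /= !expg1 !expg0 !mul1g.
Qed.

Lemma dicyclic_isomorphic n (G H : groupType) (a b : G) (c d : H) :
  (1 < n)%N -> dicyclic_rel n a b -> has_order a n.*2 ->
  dicyclic_rel n c d -> has_order c n.*2 ->
  isomorphic (subgroup_generated [set a; b]) (subgroup_generated [set c; d]).
Proof.
move=> n_gt1 ab_rel oa cd_rel oc; have n_gt0 := ltnW n_gt1.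
rewrite (dicyclic_generated ab_rel n_gt0) (dicyclic_generated cd_rel n_gt0).
apply: graph_isomorphic; first exact: (dicyclic_pair_subgroup (n := n)).
move=> [i j]; split.
  move=> /(dicyclic_nf_faithful ab_rel n_gt1 oa)[].
  exact: dicyclic_nf_eq1.
move=> /(dicyclic_nf_faithful cd_rel n_gt1 oc)[].
exact: dicyclic_nf_eq1.
Qed.

(** * The binary tetrahedral group *)

(** The exponent of the quaternion group is 4. *)
Lemma dicyclic_nfX4 (G : groupType) (a b : G) ij :
  dicyclic_rel 2 a b -> dicyclic_nf a b ij ^+ 4 = 1.
Proof.
case: ij => i j ab_rel; rewrite (dicyclic_nfE ab_rel).
move: (i + _)%N => {}i; case: (odd j); last first.
  rewrite expg0 mulg1 -expgM mulnC expgM.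
  by have /= -> := dicyclic_a2n ab_rel; rewrite expg1n.
rewrite expg1 (expgM _ 2 2).
have -> : (a ^+ i * b) ^+ 2 = b ^+ 2.
  by rewrite expg2 mulgA -(mulgA _ b) (dicyclic_bX ab_rel) mulKVg.
by rewrite -expgM (dicyclic_b4 ab_rel).
Qed.

Definition tetrahedral_nf (G : groupType) (x1 x2 x3 : G)
    (ijk : (nat * nat) * nat) : G :=
  dicyclic_nf x1 x2 ijk.1 * x3 ^+ ijk.2.

Section Relations.
Variables (G : groupType) (z x1 x2 x3 : G).
Hypothesis x_rel : SL2F3_relations [:: z; x1; x2; x3].

(** Conjugation by x3 maps x1 to x2 and x2 to x1 x2, so z is also the square of
    x1 x2; but x2 x1 = z x1 x2 computes this square as z^3. *)
Lemma tetrahedral_z2 : z ^+ 2 = 1.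
Proof.
have [[x1z x2z] _ x21 x31 x32] := x_rel.
have conj2 y : (x3 * y * x3^-1) ^+ 2 = x3 * y ^+ 2 * x3^-1.
  by rewrite !expg2 !mulgA mulgKV.
have x12 : (x1 * x2) ^+ 2 = z.
  by rewrite -x32 conj2 x2z -x1z -conj2 x31 x2z x1z.
have : z * z ^+ 2 = z.
  rewrite -[in RHS]x12 [in RHS]expg2 -[in RHS]mulgA (mulgA x2) x21.
  by rewrite -!mulgA -[x2 * x2]expg2 x2z -x1z !expg2 !mulgA.
by move=> zz; apply: (mulgI z); rewrite zz mulg1.
Qed.

Lemma tetrahedral_dicyclic : dicyclic_rel 2 x1 x2.
Proof.
have [[x1z x2z] _ x21 _ _] := x_rel; split; first by rewrite x1z.
rewrite -mulgA x21 -x1z -[RHS]mul1g -tetrahedral_z2 -x1z.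
by rewrite !expg2 !mulgA.
Qed.

(** Conjugation by x3 stabilizes the subgroup Q generated by x1 and x2, so the
    products q x3^k with q in Q are closed under left multiplication by the
    generators. *)
Lemma tetrahedral_generated :
  subgroup_generated [set x1; x2; x3] = range (tetrahedral_nf x1 x2 x3).
Proof.
have [_ x33 _ x31 x32] := x_rel; have dic := tetrahedral_dicyclic.
pose Q := subgroup_generated [set x1; x2].
have Qsub : is_subgroup Q := subgroup_generated_subgroup _.
have QE : Q = range (dicyclic_nf x1 x2) by exact: (dicyclic_generated dic).
have [Q1 Q2] : Q x1 /\ Q x2.
  by split; apply: subset_subgroup_generated; [left|right].
have Qconj : Q `<=` [set q | Q (x3 * q * x3^-1)].
  apply: subgroup_generated_min.
    apply: is_subgroupP => /=.
    - by rewrite mulg1 mulgV; exact: (subgroup1 Qsub).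
    - by move=> x y Qx Qy; have := subgroupM Qsub Qx Qy; rewrite !mulgA mulgKV.
    - by move=> x /(subgroupV Qsub); rewrite !invgM invgK mulgA.
  by move=> _ [->|->] /=; [rewrite x31|rewrite x32; exact: (subgroupM Qsub)].
have SE q k : Q q -> range (tetrahedral_nf x1 x2 x3) (q * x3 ^+ k).
  by rewrite QE => -[ij _ <-]; exists (ij, k).
have QS ij : Q (dicyclic_nf x1 x2 ij) by rewrite QE; exists ij.
apply: subgroup_generated_left_mul.
- by have := SE 1 0%N (subgroup1 Qsub); rewrite expg0 mulg1.
- move=> x _ X [[ij k] _ <-].
  have -> : x * tetrahedral_nf x1 x2 x3 (ij, k)
            = x * dicyclic_nf x1 x2 ij * x3 ^+ k by rewrite -mulgA.
  case: X => [[->|->]|->]; [apply/SE..|].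
  + exact: (subgroupM Qsub).
  + exact: (subgroupM Qsub).
  + rewrite -(mulgKV x3 (x3 * _)) -mulgA -expgS; exact: (SE _ _ (Qconj _ (QS _))).
- move=> _ [[->|->]|->]; [exists 3%N|exists 3%N|by exists 2%N].
    exact: (dicyclic_a2n dic).
  exact: (dicyclic_b4 dic).
- have gen_sub := subgroup_generated_subgroup [set x1; x2; x3].
  move=> _ [[ij k] _ <-]; apply: (subgroupM gen_sub).
    apply: (subgroup_generated_min gen_sub _ (QS ij)) => x.
    by case=> ->; apply: subset_subgroup_generated; left; [left|right].
  by apply: (subgroupX gen_sub); apply: subset_subgroup_generated; right.
Qed.

Lemma tetrahedral_nf_eq1 i j k : ~~ odd j -> (4 %| i + 2 * j./2)%N ->
  (3 %| k)%N -> tetrahedral_nf x1 x2 x3 ((i, j), k) = 1.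
Proof.
have [_ x33 _ _ _] := x_rel; move=> j_even ij /dvdnP[l ->].
rewrite /tetrahedral_nf (dicyclic_nf_eq1 tetrahedral_dicyclic) //=.
by rewrite mulnC expgM x33 expg1n mul1g.
Qed.

(** The quotients of the group by its nontrivial normal subgroups all kill z: if
    z <> 1, nothing collapses. *)
Hypothesis z1 : z <> 1.

Lemma tetrahedral_order1 : has_order x1 4.
Proof.
have [[x1z _] _ _ _ _] := x_rel.
apply: has_orderP => // [|[|[|[|[|i]]]]] //.
- by rewrite (expgM _ 2 2) x1z tetrahedral_z2.
- by move=> _ x11; apply: z1; move: x11; rewrite -x1z expg1 => ->; rewrite expg1n.
- by rewrite x1z.
- move=> _ x11; apply: z1.
  rewrite -[z]mulg1 -[X in _ * X]tetrahedral_z2 -expgS -x1z.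
  by rewrite -expgM (expgM _ 3 2) x11 expg1n.
Qed.

Lemma tetrahedral_order3 : has_order x3 3.
Proof.
have [[x1z _] x33 _ x31 x32] := x_rel.
have x3_neq1 : x3 <> 1.
  move=> x3E; move: x31 x32; rewrite x3E invg1 !mulg1 !mul1g => _ x12.
  apply: z1; rewrite -x1z; have -> : x1 = 1; last by rewrite expg1n.
  by apply: (mulIg x2); rewrite mul1g.
apply: has_orderP => // -[|[|[|i]]] // _ x3i; apply: x3_neq1.
by rewrite -[LHS]mulg1 -[X in _ * X]x3i -expgS.
Qed.

(** If q x3^k = 1 with q in the quaternion group, then x3^(4k) = 1 because
    q^4 = 1; as x3 has order 3, k is a multiple of 3, and then q = 1. *)
Lemma tetrahedral_nf_faithful i j k :
  tetrahedral_nf x1 x2 x3 ((i, j), k) = 1 ->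
  [/\ ~~ odd j, (4 %| i + 2 * j./2)%N & (3 %| k)%N].
Proof.
rewrite /tetrahedral_nf /= => nf1; have dic := tetrahedral_dicyclic.
have k3 : (3 %| k)%N.
  have : x3 ^- k ^+ 4 = 1.
    rewrite -(dicyclic_nfX4 (i, j) dic); congr (_ ^+ _).
    by apply: (mulIg (x3 ^+ k)); rewrite mulVg nf1.
  rewrite expVgn -expgM => /(congr1 invg); rewrite invgK invg1.
  by move=> /tetrahedral_order3; rewrite Gauss_dvdl.
move: nf1; rewrite ((tetrahedral_order3 _).2 k3) mulg1.
by move=> /(dicyclic_nf_faithful dic isT tetrahedral_order1)[].
Qed.

End Relations.

Lemma tetrahedral_rel_pair (G H : groupType) (z x1 x2 x3 : G)
    (t y1 y2 y3 : H) :
  SL2F3_relations [:: z; x1; x2; x3] -> SL2F3_relations [:: t; y1; y2; y3] ->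
  @SL2F3_relations (G * H)%type [:: (z, t); (x1, y1); (x2, y2); (x3, y3)].
Proof.
move=> [[? ?] ? ? ? ?] [[? ?] ? ? ? ?].
by split; first split; rewrite ?expg_pair; congr pair.
Qed.

Lemma tetrahedral_pair_subgroup (G H : groupType) (z x1 x2 x3 : G)
    (t y1 y2 y3 : H) :
  SL2F3_relations [:: z; x1; x2; x3] -> SL2F3_relations [:: t; y1; y2; y3] ->
  is_subgroup (range (fun i => (tetrahedral_nf x1 x2 x3 i,
                                tetrahedral_nf y1 y2 y3 i) : (G * H)%type)).
Proof.
move=> x_rel y_rel; have r := tetrahedral_rel_pair x_rel y_rel.
rewrite (_ : (fun i => _) = tetrahedral_nf ((x1, y1) : (G * H)%type)
                            ((x2, y2) : (G * H)%type) ((x3, y3) : (G * H)%type)).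
  by rewrite -(tetrahedral_generated r); exact: subgroup_generated_subgroup.
by apply/funext => i; rewrite /tetrahedral_nf /dicyclic_nf !expg_pair.
Qed.

Lemma tetrahedral_morphism (G H : groupType) (z x1 x2 x3 : G)
    (t y1 y2 y3 : H) :
  SL2F3_relations [:: z; x1; x2; x3] -> z <> 1 ->
  SL2F3_relations [:: t; y1; y2; y3] ->
  exists f : G -> H,
    {in subgroup_generated [set x1; x2; x3] &, {morph f : x y / x * y}} /\
    [/\ f x1 = y1, f x2 = y2 & f x3 = y3].
Proof.
move=> x_rel z1 y_rel.
have [|f [fM fE]] := graph_morphism (tetrahedral_pair_subgroup x_rel y_rel).
  move=> [[i j] k] /(tetrahedral_nf_faithful x_rel z1)[].
  exact: (tetrahedral_nf_eq1 y_rel).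
exists f; rewrite (tetrahedral_generated x_rel); split=> //.
have := (fE (1, 0, 0), fE (0, 1, 0), fE (0, 0, 1))%N.
by rewrite /tetrahedral_nf /dicyclic_nf /= !expg1 !expg0 !mulg1 !mul1g => -[[]].
Qed.

Lemma tetrahedral_isomorphic (G H : groupType) (z x1 x2 x3 : G)
    (t y1 y2 y3 : H) :
  SL2F3_relations [:: z; x1; x2; x3] -> z <> 1 ->
  SL2F3_relations [:: t; y1; y2; y3] -> t <> 1 ->
  isomorphic (subgroup_generated [set x1; x2; x3])
             (subgroup_generated [set y1; y2; y3]).
Proof.
move=> x_rel z1 y_rel t1.
rewrite (tetrahedral_generated x_rel) (tetrahedral_generated y_rel).
apply: graph_isomorphic; first exact: (tetrahedral_pair_subgroup x_rel y_rel).
move=> [[i j] k]; split.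
  move=> /(tetrahedral_nf_faithful x_rel z1)[].
  exact: (tetrahedral_nf_eq1 y_rel).
move=> /(tetrahedral_nf_faithful y_rel t1)[].
exact: (tetrahedral_nf_eq1 x_rel).
Qed.

(** * Groups with an integral trace *)

Section IntegralTrace.
Variables (G : groupType) (K : set G) (z : G) (t : G -> int).

(** What is needed of the trace on a finite subgroup of SL(2, R).  The functional
    equation comes from the Cayley-Hamilton identity h + h^-1 = tr h; the
    parameter z stands for -I, which need not be in K. *)
Record integral_trace : Prop := IntegralTrace {
  integral_trace_subgroup : is_subgroup K;
  integral_traceM : forall g h, K g -> K h ->
    (t (g * h) + t (g * h^-1) = t g * t h)%R;
  integral_trace_bound : forall g, K g -> (-2 <= t g <= 2)%R;
  integral_trace_eq2 : forall g, K g -> t g = 2%R <-> g = 1;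
  integral_trace_eqN2 : forall g, K g -> t g = (-2)%R -> g = z }.

Inductive integral_trace_type : Prop :=
  | TraceC1 of K = [set 1]
  | TraceC2 of K z & t z = (-2)%R & K = subgroup_generated [set z]
  | TraceC4 g of K g & t g = 0%R & K = subgroup_generated [set g]
  | TraceQ8 a b of K a & K b & t a = 0%R & t b = 0%R & t (a * b) = 0%R &
      K = subgroup_generated [set a; b]
  | TraceC3 g of K g & t g = (-1)%R & K = subgroup_generated [set g]
  | TraceC6 g of K g & t g = 1%R & K = subgroup_generated [set g]
  | TraceQ12 a b of K a & K b & t a = 1%R & t b = 0%R & t (a * b) = 0%R &
      K = subgroup_generated [set a; b]
  | TraceT24 x1 x2 x3 of K x1 & K x2 & K x3 &
      t x1 = 0%R & t x2 = 0%R & t x3 = (-1)%R & t (x1 * x2) = 0%R &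
      x3 * x1 * x3^-1 = x2 & x3 * x2 * x3^-1 = x1 * x2 &
      K = subgroup_generated [set x1; x2; x3].

Hypothesis Kt : integral_trace.
Let Ksub := integral_trace_subgroup Kt.
Let tM := integral_traceM Kt.
Let K1 : K 1 := subgroup1 Ksub.
Let KM x y : K x -> K y -> K (x * y) := subgroupM Ksub (x:=x) (y:=y).
Let KV x : K x -> K x^-1 := subgroupV Ksub (x:=x).
Let KX x n : K x -> K (x ^+ n) := subgroupX Ksub (x:=x) n.

(* The arithmetic only relates the integers t x, which become variables. *)
Ltac trace_lia :=
  repeat match goal with
  | H : @eq ?T _ _ |- _ => unify T int; revert H
  | H : not (@eq ?T _ _) |- _ => unify T int; revert H
  | H : is_true (_ <= _ <= _)%R |- _ => revert H
  | H : not (or (@eq ?T _ _) _) |- _ => unify T int; revert H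
  | H : and (not (@eq ?T _ _)) _ |- _ => unify T int; revert H
  end;
  repeat match goal with |- context [t ?x] => move: (t x) => ? end;
  lia.

Lemma trace1 : t 1 = 2%R.
Proof. exact/integral_trace_eq2. Qed.

Lemma traceV g : K g -> t g^-1 = t g.
Proof. by move=> Kg; have := tM K1 Kg; rewrite !mul1g trace1; trace_lia. Qed.

Lemma traceC g h : K g -> K h -> t (g * h) = t (h * g).
Proof.
move=> Kg Kh; have := tM Kg Kh; have := tM Kh Kg.
by rewrite -(traceV (KM Kg (KV Kh))) invgM invgK; trace_lia.
Qed.

Lemma traceJ g h : K g -> K h -> t (g * h * g^-1) = t h.
Proof.
by move=> Kg Kh; rewrite traceC ?mulKg //; [exact: KM|exact: KV].
Qed.

Lemma trace_expS g n : K g ->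
  t (g ^+ n.+2) = (t (g ^+ n.+1) * t g - t (g ^+ n))%R.
Proof.
by move=> Kg; have := tM (KX n.+1 Kg) Kg; rewrite -expgSr (expgSr _ n) mulgK; trace_lia.
Qed.

(** The powers of g are told apart from 1 by their traces, which depend on t g
    only through the recurrence [trace_expS]. *)
Lemma trace_order g n : K g -> (0 < n)%N -> t (g ^+ n) = 2%R ->
  (forall i, (0 < i < n)%N -> t (g ^+ i) <> 2%R) -> has_order g n.
Proof.
move=> Kg n_gt0 tn ti; apply: has_orderP => //.
  by apply/(integral_trace_eq2 Kt) => //; exact: KX.
by move=> i i_n gi; apply: (ti i) => //; rewrite gi trace1.
Qed.

Lemma traceN2_order g : K g -> t g = (-2)%R -> has_order g 2.
Proof.
move=> Kg tg; have e2 := trace_expS 0 Kg.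
rewrite expg0 expg1 trace1 tg in e2.
apply: (trace_order Kg); [by []|by trace_lia|].
move=> [|[|[|i]]] //; rewrite ?expg1. all: trace_lia.
Qed.

Lemma traceN1_order g : K g -> t g = (-1)%R -> has_order g 3.
Proof.
move=> Kg tg; have e2 := trace_expS 0 Kg; have e3 := trace_expS 1 Kg.
rewrite ?expg0 !expg1 ?trace1 tg in e2 e3.
apply: (trace_order Kg); [by []|by trace_lia|].
move=> [|[|[|[|i]]]] //; rewrite ?expg1. all: trace_lia.
Qed.

Lemma trace0_order g : K g -> t g = 0%R -> has_order g 4.
Proof.
move=> Kg tg; have e2 := trace_expS 0 Kg; have e3 := trace_expS 1 Kg.
have e4 := trace_expS 2 Kg.
rewrite ?expg0 ?expg1 ?trace1 tg in e2 e3 e4.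
apply: (trace_order Kg); [by []|by trace_lia|].
move=> [|[|[|[|[|i]]]]] //; rewrite ?expg1. all: trace_lia.
Qed.

Lemma trace1_order g : K g -> t g = 1%R -> has_order g 6.
Proof.
move=> Kg tg; have e2 := trace_expS 0 Kg; have e3 := trace_expS 1 Kg.
have e4 := trace_expS 2 Kg; have e5 := trace_expS 3 Kg.
have e6 := trace_expS 4 Kg.
rewrite ?expg0 ?expg1 ?trace1 tg in e2 e3 e4 e5 e6.
apply: (trace_order Kg); [by []|by trace_lia|].
move=> [|[|[|[|[|[|[|i]]]]]]] //; rewrite ?expg1. all: trace_lia.
Qed.

Lemma trace0_sqr g : K g -> t g = 0%R -> g ^+ 2 = z /\ t z = (-2)%R.
Proof.
move=> Kg tg; have e2 := trace_expS 0 Kg.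
rewrite expg0 expg1 trace1 tg in e2.
have gz : g ^+ 2 = z by apply: (integral_trace_eqN2 Kt) (KX _ Kg) _; trace_lia.
by split=> //; rewrite -gz; trace_lia.
Qed.

Lemma trace1_cube g : K g -> t g = 1%R -> g ^+ 3 = z /\ t z = (-2)%R.
Proof.
move=> Kg tg; have e2 := trace_expS 0 Kg; have e3 := trace_expS 1 Kg.
rewrite ?expg0 !expg1 ?trace1 tg in e2 e3.
have gz : g ^+ 3 = z by apply: (integral_trace_eqN2 Kt) (KX _ Kg) _; trace_lia.
by split=> //; rewrite -gz; trace_lia.
Qed.

(** Both g and h g have trace 0, so they have the same square z. *)
Lemma trace0_braid g h : K g -> K h -> t g = 0%R -> t (g * h) = 0%R ->
  h * g * h = g.
Proof.
move=> Kg Kh tg tgh; have [gz _] := trace0_sqr Kg tg.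
have [hgz _] := trace0_sqr (KM Kh Kg) (etrans (traceC Kh Kg) tgh).
by apply: (mulIg g); rewrite -expg2 gz -hgz expg2 mulgA.
Qed.

(** By the extreme values of the trace, g h is 1 or z. *)
Lemma mem_of_trace (S : set G) g h : is_subgroup S -> S z -> K g -> K h ->
  S h -> t (g * h) = 2%R \/ t (g * h) = (-2)%R -> S g.
Proof.
move=> Ssub Sz Kg Kh Sh tgh; rewrite -(mulgK h g).
apply: (subgroupM Ssub); last exact: (subgroupV Ssub).
case: tgh => [/(integral_trace_eq2 Kt (KM Kg Kh))->|].
  exact: subgroup1.
by move=> /(integral_trace_eqN2 Kt (KM Kg Kh))->.
Qed.

Section CentralInvolution.
Hypotheses (Kz : K z) (tz : t z = (-2)%R).

Lemma trace_z2 : z * z = 1.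
Proof. by rewrite -expg2; apply/(traceN2_order Kz tz). Qed.

Lemma trace_zM g : K g -> t (z * g) = (- t g)%R.
Proof.
move=> Kg; have := tM Kg Kz; have -> : z^-1 = z.
  by apply: (mulgI z); rewrite mulgV trace_z2.
by rewrite (traceC Kg Kz) tz; trace_lia.
Qed.

Lemma trace_zC g : K g -> g * z = z * g.
Proof.
move=> Kg; have : g * z * g^-1 = z.
  apply: (integral_trace_eqN2 Kt); last by rewrite traceJ.
  by apply: KM; [exact: KM|exact: KV].
by move=> {2}<-; rewrite mulgVK.
Qed.

Lemma trace0_anticommute g h : K g -> K h ->
  t g = 0%R -> t h = 0%R -> t (g * h) = 0%R -> h * g = z * (g * h).
Proof.
move=> Kg Kh tg th tgh; have [hz _] := trace0_sqr Kh th.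
apply: (mulIg h); rewrite (trace0_braid Kg Kh tg tgh).
by rewrite -!mulgA -expg2 hz (trace_zC Kg) mulgA trace_z2 mul1g.
Qed.

End CentralInvolution.

Lemma trace_cases g : K g ->
  [\/ t g = (-2)%R, t g = (-1)%R, t g = 0%R | t g = 1%R] \/ t g = 2%R.
Proof.
move=> /(integral_trace_bound Kt) tg.
have : t g = (-2)%R \/ t g = (-1)%R \/ t g = 0%R \/ t g = 1%R \/ t g = 2%R.
  by trace_lia.
by case=> [?|[?|[?|[?|?]]]]; [left|left|left|left|right];
  [constructor 1|constructor 2|constructor 3|constructor 4|].
Qed.

(** All traces are even, so an element outside a subgroup S containing z is
    orthogonal to all of S: it has trace 0 and anticommutes with the elements of
    trace 0 of S.  This leaves room for two generators at most. *)
Lemma integral_trace_even :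
  (forall g, K g -> t g <> 1%R /\ t g <> (-1)%R) -> integral_trace_type.
Proof.
move=> t_even.
have genK (X : set G) : X `<=` K -> subgroup_generated X `<=` K.
  exact: subgroup_generated_min.
have [[g [Kg tg]]|no0] := pselect (exists g, K g /\ t g = 0%R); last first.
  have tK g : K g -> g = 1 \/ (t g = (-2)%R /\ g = z).
    move=> Kg; have [te1 te2] := t_even g Kg.
    have t0 : t g <> 0%R by move=> t0; apply: no0; exists g.
    have [[tg|tg|tg|tg]|tg] := trace_cases Kg => //.
      by right; split=> //; exact: (integral_trace_eqN2 Kt).
    by left; apply/(integral_trace_eq2 Kt Kg).
  have [[g [Kg tg]]|noz] := pselect (exists g, K g /\ t g = (-2)%R).
    have gz := integral_trace_eqN2 Kt Kg tg; rewrite gz in Kg tg.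
    apply: TraceC2 => //; apply/seteqP; split; last by apply: genK => _ ->.
    move=> h /tK[->|[_ ->]]; last exact: subset_subgroup_generated.
    exact: (subgroup1 (subgroup_generated_subgroup _)).
  apply: TraceC1; apply/seteqP; split=> [h Kh|_ ->] //=.
  by have [//|[th _]] := tK h Kh; case: noz; exists h.
have [gz tz] := trace0_sqr Kg tg; have Kz : K z by rewrite -gz; exact: KX.
pose S1 := subgroup_generated [set g].
have S1sub : is_subgroup S1 := subgroup_generated_subgroup _.
have S1g : S1 g by exact: subset_subgroup_generated.
have S1z : S1 z by rewrite -gz; exact: (subgroupX S1sub).
have t_out (S : set G) h k : is_subgroup S -> S z -> K h -> K k -> S k ->
    ~ S h -> t (h * k) = 0%R.
  move=> Ssub Sz Kh Kk Sk Sh.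
  have := t_even _ (KM Kh Kk).
  have nt : ~ (t (h * k) = 2%R \/ t (h * k) = (-2)%R).
    by move=> thk; apply: Sh; exact: mem_of_trace thk.
  have := integral_trace_bound Kt (KM Kh Kk); trace_lia.
have [KS1|/existsNP[h /not_implyP[Kh S1h]]] := pselect (K `<=` S1).
  by apply: (TraceC4 Kg tg); apply/seteqP; split=> //; apply: genK => _ ->.
have th : t h = 0%R.
  by rewrite -[h]mulg1; apply: t_out S1h => //; exact: subgroup1.
have thg : t (h * g) = 0%R by exact: t_out S1h.
apply: (TraceQ8 Kh Kg th tg thg); apply/seteqP; split; last first.
  by apply: genK => _ [->|->].
set S := subgroup_generated _.
have Ssub : is_subgroup S := subgroup_generated_subgroup _.
have Sh : S h by apply: subset_subgroup_generated; left.
have Sg : S g by apply: subset_subgroup_generated; right.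
have Sz : S z by rewrite -gz; exact: (subgroupX Ssub).
move=> x Kx; apply: contrapT => Sx.
have tx : t x = 0%R.
  by rewrite -[x]mulg1; apply: t_out Sx => //; exact: subgroup1.
have Khg := KM Kh Kg.
have txh : t (x * h) = 0%R by exact: t_out Sx.
have txg : t (x * g) = 0%R by exact: t_out Sx.
have txhg : t (x * (h * g)) = 0%R by apply: t_out Sx => //; exact: (subgroupM Ssub).
(* an element of trace 0 orthogonal to h and to g commutes with h * g, so it
   cannot also anticommute with it *)
have xh := trace0_anticommute Kz tz Kx Kh tx th txh.
have xg := trace0_anticommute Kz tz Kx Kg tx tg txg.
have := trace0_anticommute Kz tz Kx Khg tx thg txhg.
rewrite -mulgA xg mulgA (trace_zC Kz tz Kh) -mulgA (mulgA h x) xh.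
rewrite -!mulgA => /mulgI zE.
have z1 : z = 1 by apply: (mulIg (x * (h * g))); rewrite zE mul1g.
by move: tz; rewrite z1 trace1.
Qed.

(** Elements of trace 0 or 1 have a power equal to z, so all nontrivial traces
    are -1.  For h outside the group of u, the functional equation
    t(hu) + t(hu^-1) = 1 cannot be solved with both terms equal to -1. *)
Lemma integral_trace_no_involution u : K u -> t u = (-1)%R ->
  (forall g, K g -> t g <> (-2)%R) -> integral_trace_type.
Proof.
move=> Ku tu noz; apply: (TraceC3 Ku tu); apply/seteqP; split; last first.
  by apply: (subgroup_generated_min Ksub) => _ ->.
have Ssub := subgroup_generated_subgroup [set u].
have Su : subgroup_generated [set u] u by exact: subset_subgroup_generated.
have tK g : K g -> t g = 2%R \/ t g = (-1)%R.
  move=> Kg; have n0 : t g <> 0%R.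
    by move=> tg; have [gz tz] := trace0_sqr Kg tg;
      apply: (noz (g ^+ 2)); [exact: KX|rewrite gz].
  have n1 : t g <> 1%R.
    by move=> tg; have [gz tz] := trace1_cube Kg tg;
      apply: (noz (g ^+ 3)); [exact: KX|rewrite gz].
  by have n2 := noz g Kg; have [[?|?|?|?]|?] := trace_cases Kg => //; [right|left].
move=> h Kh.
have [/(integral_trace_eq2 Kt Kh)->|th] := tK h Kh; first exact: (subgroup1 Ssub).
have := tM Kh Ku; rewrite th tu => hu.
have [thu|thu] := tK _ (KM Kh Ku).
  rewrite -(mulgK u h) ((integral_trace_eq2 Kt (KM Kh Ku)).1 thu) mul1g.
  exact: (subgroupV Ssub).
have [thv|thv] := tK _ (KM Kh (KV Ku)); last by exfalso; trace_lia.
rewrite -(mulgVK u h) ((integral_trace_eq2 Kt (KM Kh (KV Ku))).1 thv) mul1g.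
exact: Su.
Qed.

(** Up to sign and a factor 2, the cosine of the angle between h and its
    conjugate by g: this is how pairs of orthogonal elements of trace 0 are
    found. *)
Lemma trace_conj_mul g h : K g -> K h -> t h = 0%R ->
  t (h * (g * h * g^-1)) = (2 - t (h * g) * t (h * g) - t g * t g)%R.
Proof.
move=> Kg Kh th; have Kg' := KV Kg.
have e1 := tM (KM Kh Kg) (KM Kh Kg'); have e2 := tM Kh Kg.
have e3 := trace_expS 0 Kg.
rewrite expg0 expg1 trace1 expg2 in e3.
rewrite invgM invgK in e1.
have e4 := traceJ Kh (KM Kg Kg).
have e5 : h * g * (g * h^-1) = h * (g * g) * h^-1 by rewrite !mulgA.
rewrite e5 in e1.
rewrite e4 e3 in e1; rewrite th in e2; rewrite !mulgA in e1 *.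
have e6 : t (h * g^-1) = (- t (h * g))%R by trace_lia.
rewrite e6 in e1; trace_lia.
Qed.

Section Orthogonal.
Variables a b : G.
Hypotheses (Ka : K a) (Kb : K b).
Hypotheses (ta : t a = 0%R) (tb : t b = 0%R) (tab : t (a * b) = 0%R).

Let az : a ^+ 2 = z := (trace0_sqr Ka ta).1.
Let tz : t z = (-2)%R := (trace0_sqr Ka ta).2.
Let Kz : K z.
Proof. by rewrite -az; exact: KX. Qed.

(* The functional equation for the product (w a) (a h), where a^2 = z. *)
Let tM2 w h : K w -> K h -> (t (w * h) + t (a^-1 * w * a * h)
  = t w * t h - t (w * a) * t (a * h))%R.
Proof.
move=> Kw Kh; have Ka' := KV Ka.
have e1 := tM (KM Kw Ka) (KM Ka Kh).
have Kwa : K (a^-1 * w * a) by apply: KM => //; exact: KM.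
have e2 := tM Kwa Kh.
rewrite invgM in e1.
have e3 : t (w * a * (a * h)) = (- t (w * h))%R.
  rewrite -(trace_zM Kz tz (KM Kw Kh)) mulgA -(mulgA w) -expg2 az.
  by rewrite (trace_zC Kz tz Kw) mulgA.
have e4 : t (w * a * (h^-1 * a^-1)) = t (a^-1 * w * a * h^-1).
  rewrite mulgA traceC ?mulgA //; apply: KM; [exact: KM|exact: KV].
have e5 : t (a^-1 * w * a) = t w.
  by rewrite -[X in _ * X]invgK traceJ.
rewrite e3 e4 in e1; rewrite e5 in e2; trace_lia.
Qed.

Let conj2 h g : K h -> K g -> t g = 0%R ->
  t (g^-1 * h * g * h) = (2 - t (h * g) * t (h * g))%R.
Proof.
move=> Kh Kg tg; have [gz _] := trace0_sqr Kg tg; have Kg' := KV Kg.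
have e1 := tM (KM Kh Kg) (KM Kh Kg').
have e2 := tM Kh Kg; rewrite tg in e2.
have e3 : t (h * g * (h * g^-1)) = t (g^-1 * h * g * h).
  by rewrite mulgA traceC ?mulgA //; apply: KM => //; exact: KM.
have e4 : t (h * g * (h * g^-1)^-1) = (-2)%R.
  by rewrite invgM invgK mulgA -(mulgA h) -expg2 gz traceJ.
rewrite e3 e4 in e1.
have e5 : t (h * g^-1) = (- t (h * g))%R by trace_lia.
by rewrite e5 in e1; trace_lia.
Qed.

(** Parseval's identity: for the inner product t(gh^-1)/2, the elements 1, a, b
    and ba form an orthonormal basis of a quaternion algebra, where h is a unit
    vector.  Here it is derived from the functional equation: with h^b and
    h^(ba) the conjugates of h, the sum of the traces of h^b h and h^(ba) h is
    computed in two ways. *)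
Lemma trace_sum_squares h : K h ->
  (t h * t h + t (h * a) * t (h * a) + t (h * b) * t (h * b)
   + t (h * (b * a)) * t (h * (b * a)) = 4)%R.
Proof.
move=> Kh; have Kb' := KV Kb; have Kba := KM Kb Ka.
have tba : t (b * a) = 0%R by rewrite traceC.
have Kw : K (b^-1 * h * b) by apply: KM => //; exact: KM.
have e1 := tM2 Kw Kh.
have e2 : t (b^-1 * h * b) = t h by rewrite -[X in _ * X]invgK traceJ.
have e3 : t (b^-1 * h * b * a) = (- t (h * a))%R.
  rewrite -mulgA (trace0_anticommute Kz tz Ka Kb ta tb tab).
  rewrite mulgA (trace_zC Kz tz); last exact: KM.
  rewrite -mulgA (trace_zM Kz tz); last by do 2?apply: KM.
  congr (- _)%R; rewrite [LHS]traceC; [|exact: KM..].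
  by rewrite !mulgA mulgK traceC.
have e4 : a^-1 * (b^-1 * h * b) * a * h = (b * a)^-1 * h * (b * a) * h.
  by rewrite invgM !mulgA.
have e5 := conj2 Kh Kb tb; have e6 := conj2 Kh Kba tba.
rewrite e2 e3 e4 (traceC Ka Kh) in e1.
trace_lia.
Qed.

End Orthogonal.

Lemma square_cases (x : int) : (-2 <= x <= 2 ->
  x = 0 /\ x * x = 0 \/ (x = 1 \/ x = -1) /\ x * x = 1
  \/ (x = 2 \/ x = -2) /\ x * x = 4)%R.
Proof.
move=> x_bound.
have : (x = 0 \/ x = 1 \/ x = -1 \/ x = 2 \/ x = -2)%R by lia.
by case=> [->|[->|[->|[->|->]]]]; lia.
Qed.

(** When no two elements of trace 0 are orthogonal, every i of trace 0 is
    orthogonal to every w of trace 1: otherwise t(iw) = 1 or -1, and i would be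
    orthogonal to its conjugate by w.  Then two elements v, w of trace 1 generate
    the same subgroup, because t(vw) + t(vw^-1) = 1 and neither term can vanish:
    an element vw or vw^-1 of trace 0 would be orthogonal to w.  So w and i
    generate K. *)
Lemma integral_trace_hexagonal w i : K w -> t w = 1%R -> K i -> t i = 0%R ->
  (forall a b, K a -> K b -> t a = 0%R -> t b = 0%R -> t (a * b) <> 0%R) ->
  integral_trace_type.
Proof.
move=> Kw tw Ki ti no_pair.
have [wz tz] := trace1_cube Kw tw; have Kz : K z by rewrite -wz; exact: KX.
have orth v j : K v -> K j -> t v = 1%R -> t j = 0%R -> t (j * v) = 0%R.
  move=> Kv Kj tv tj; have Kjv := KM Kj Kv.
  have e1 := trace_conj_mul Kv Kj tj; rewrite tv in e1.
  have Kvj : K (v * j * v^-1) by apply: KM; [exact: KM|exact: KV].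
  have e2 := no_pair _ _ Kj Kvj tj; rewrite traceJ // in e2.
  have := e2 tj; rewrite e1 => e3.
  have n2 : t (j * v) <> 2%R.
    move=> /(integral_trace_eq2 Kt Kjv) jv.
    have jE : j = v^-1 by rewrite -(mulgK v j) jv mul1g.
    by move: tj; rewrite jE traceV // tv.
  have nN2 : t (j * v) <> (-2)%R.
    move=> /(integral_trace_eqN2 Kt Kjv) jv.
    have jE : j = z * v^-1 by rewrite -(mulgK v j) jv.
    by move: tj; rewrite jE (trace_zM Kz tz) ?traceV // ?tv //; exact: KV.
  have [[jv|jv|//|jv]|jv] := trace_cases Kjv => //; by move: e3; rewrite jv.
have tw' : t (w * i) = 0%R by rewrite traceC // orth.
apply: (TraceQ12 Kw Ki tw ti tw'); apply/seteqP; split; last first.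
  by apply: (subgroup_generated_min Ksub) => _ [->|->].
set S := subgroup_generated _.
have Ssub : is_subgroup S := subgroup_generated_subgroup _.
have Sw : S w by apply: subset_subgroup_generated; left.
have Si : S i by apply: subset_subgroup_generated; right.
have Sz : S z by rewrite -wz; exact: (subgroupX Ssub).
have S1 v : K v -> t v = 1%R -> S v.
  move=> Kv tv; have Kvw := KM Kv Kw; have Kvw' := KM Kv (KV Kw).
  apply: contrapT => Sv.
  have n1 : ~ (t (v * w) = 2%R \/ t (v * w) = (-2)%R).
    by move=> tvw; apply: Sv; exact: mem_of_trace tvw.
  have n2 : ~ (t (v * w^-1) = 2%R \/ t (v * w^-1) = (-2)%R).
    move=> tvw; apply: Sv; apply: mem_of_trace tvw => //; first exact: KV.
    exact: (subgroupV Ssub).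
  have b1 := integral_trace_bound Kt Kvw.
  have b2 := integral_trace_bound Kt Kvw'.
  have e := tM Kv Kw; rewrite tv tw in e.
  have n3 : t (v * w) <> 0%R.
    move=> tvw; have o := orth w _ Kw Kvw tw tvw.
    have e' := tM Kvw Kw; rewrite mulgK o tvw tv in e'.
    by trace_lia.
  have n4 : t (v * w^-1) <> 0%R.
    by move=> tvw; have := orth w _ Kw Kvw' tw tvw; rewrite mulgVK tv.
  by trace_lia.
have SN1 v : K v -> t v = (-1)%R -> S v.
  move=> Kv tv; have Szv : S (z * v).
    by apply: S1; [exact: KM|rewrite (trace_zM Kz tz) // tv].
  rewrite -(mulKg z v); apply: (subgroupM Ssub) => //; exact: (subgroupV Ssub).
move=> v Kv.
have [[tv|tv|tv|tv]|tv] := trace_cases Kv.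
- by rewrite (integral_trace_eqN2 Kt Kv tv).
- exact: SN1.
- have Kvi := KM Kv Ki; have nvi := no_pair _ _ Kv Ki tv ti.
  have [[tvi|tvi|//|tvi]|tvi] := trace_cases Kvi.
  + by apply: (mem_of_trace Ssub Sz Kv Ki Si); right.
  + rewrite -(mulgK i v); apply: (subgroupM Ssub); first exact: SN1.
    exact: (subgroupV Ssub).
  + rewrite -(mulgK i v); apply: (subgroupM Ssub); first exact: S1.
    exact: (subgroupV Ssub).
  + by apply: (mem_of_trace Ssub Sz Kv Ki Si); left.
- exact: S1.
- by rewrite (integral_trace_eq2 Kt Kv).1 //; exact: (subgroup1 Ssub).
Qed.


(** By Parseval's identity, four integers of absolute value at most 2 whose
    squares sum to 4 are all odd unless one of them is 2 or -2, in which case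
    the element lies in the quaternion group.  So every element h outside the
    generated subgroup has odd trace, but h, h x3 and h x3^-1 cannot all have
    odd traces since t(h x3) + t(h x3^-1) = - t(h). *)
Lemma tetrahedral_span x1 x2 x3 : K x1 -> K x2 -> K x3 ->
  t x1 = 0%R -> t x2 = 0%R -> t x3 = (-1)%R -> t (x1 * x2) = 0%R ->
  K `<=` subgroup_generated [set x1; x2; x3].
Proof.
move=> K1' K2 K3 t1 t2 t3 t12; have [zE tz] := trace0_sqr K1' t1.
set S := subgroup_generated _.
have Ssub : is_subgroup S := subgroup_generated_subgroup _.
have S1 : S x1 by apply: subset_subgroup_generated; left; left.
have S2 : S x2 by apply: subset_subgroup_generated; left; right.
have S3 : S x3 by apply: subset_subgroup_generated; right.
have Sz : S z by rewrite -zE; exact: (subgroupX Ssub).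
have out_odd v : K v -> ~ S v -> t v = 1%R \/ t v = (-1)%R.
  move=> Kv Sv.
  have n k : K k -> S k -> t (v * k) <> 2%R /\ t (v * k) <> (-2)%R.
    move=> Kk Sk; split=> tvk; apply: Sv; apply: (mem_of_trace Ssub Sz Kv Kk) => //;
      by [left|right].
  have e := trace_sum_squares K1' K2 t1 t2 t12 Kv.
  have K21 := KM K2 K1'.
  have n0 := n _ K1 (subgroup1 Ssub); rewrite mulg1 in n0.
  have n1 := n _ K1' S1; have n2 := n _ K2 S2.
  have n3 := n _ K21 (subgroupM Ssub S2 S1).
  have := square_cases (integral_trace_bound Kt Kv).
  have := square_cases (integral_trace_bound Kt (KM Kv K1')).
  have := square_cases (integral_trace_bound Kt (KM Kv K2)).
  have := square_cases (integral_trace_bound Kt (KM Kv K21)).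
  by trace_lia.
move=> h Kh; apply: contrapT => Sh.
have S3' := subgroupV Ssub S3; have K3' := KV K3.
have e := tM Kh K3; rewrite t3 in e.
have := out_odd _ Kh Sh.
have /(out_odd _ (KM Kh K3)) : ~ S (h * x3).
  by move=> Shx; apply: Sh; rewrite -(mulgK x3 h); exact: (subgroupM Ssub).
have /(out_odd _ (KM Kh K3')) : ~ S (h * x3^-1).
  by move=> Shx; apply: Sh; rewrite -(mulgVK x3 h); exact: (subgroupM Ssub).
by trace_lia.
Qed.

(** Let c and y be the conjugates of a by u and u^2.  Then a, c and y are
    pairwise orthogonal, so that y is a c or z a c.  In the second case the
    generators z a and z c satisfy the required relation. *)
Lemma integral_trace_tetrahedral a b u :
  K a -> K b -> t a = 0%R -> t b = 0%R -> t (a * b) = 0%R ->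
  K u -> t u = (-1)%R -> integral_trace_type.
Proof.
move=> Ka Kb ta tb tab Ku tu; have Ku' := KV Ku.
have [az tz] := trace0_sqr Ka ta; have Kz : K z by rewrite -az; exact: KX.
have z2 := trace_z2 Kz tz; have zC := trace_zC Kz tz.
have u3 : u ^+ 3 = 1 by apply/(traceN1_order Ku tu).
pose c := u * a * u^-1; pose y := u * c * u^-1.
have Kc : K c by apply: KM => //; exact: KM.
have Ky : K y by apply: KM => //; exact: KM.
have tc : t c = 0%R by rewrite traceJ.
have ty : t y = 0%R by rewrite traceJ.
(* As t u = -1, the other three coordinates of u are 1 or -1. *)
have tac : t (a * c) = 0%R.
  have := trace_sum_squares Ka Kb ta tb tab Ku.
  rewrite (traceC Ku Ka) (trace_conj_mul Ku Ka ta) tu => e.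
  have := square_cases (integral_trace_bound Kt (KM Ka Ku)).
  have := square_cases (integral_trace_bound Kt (KM Ku Kb)).
  have := square_cases (integral_trace_bound Kt (KM Ku (KM Kb Ka))).
  by trace_lia.
have tyc : t (y * c) = 0%R.
  rewrite traceC // -tac -(traceJ Ku (KM Ka Kc)).
  by rewrite /y {1}/c !mulgA !mulgVK.
have tya : t (y * a) = 0%R.
  have yE : y = u^-1 * a * u.
    have uu : u * u = u^-1 by apply: (mulgI u); rewrite mulgV -expg2 -expgS.
    by rewrite /y /c !mulgA uu -(mulgA _ u^-1 u^-1) -invgM uu invgK.
  rewrite -(traceJ Ku (KM Ky Ka)) yE.
  have -> : u * (u^-1 * a * u * a) * u^-1 = a * c.
    by rewrite /c !mulgA mulgV mul1g.
  exact: tac.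
have ca := trace0_anticommute Kz tz Ka Kc ta tc tac.
have ac2 : (a * c) * (a * c) = z.
  by rewrite -expg2; case: (trace0_sqr (KM Ka Kc) tac).
(* The only nonzero coordinate of y in the basis 1, a, c, c a is the last. *)
have tyca : t (y * (c * a)) = 2%R \/ t (y * (c * a)) = (-2)%R.
  have := trace_sum_squares Ka Kc ta tc tac Ky.
  rewrite ty tya tyc => e.
  have := square_cases (integral_trace_bound Kt (KM Ky (KM Kc Ka))).
  by trace_lia.
have Kyca := KM Ky (KM Kc Ka).
have yE w : y * (c * a) = w -> y = w * (a * c).
  move=> <-; rewrite ca -mulgA -(mulgA z) ac2 z2 mulg1.
  by [].
case: tyca => [/(integral_trace_eq2 Kt Kyca)|/(integral_trace_eqN2 Kt Kyca)] /yE.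
  rewrite mul1g => ycE.
  apply: (TraceT24 Ka Kc Ku ta tc tu tac _ ycE) => //.
  apply/seteqP; split; first exact: tetrahedral_span.
  by apply: (subgroup_generated_min Ksub) => _ [[->|->]|->].
move=> ycE.
have Kza := KM Kz Ka; have Kzc := KM Kz Kc.
have tza : t (z * a) = 0%R by rewrite (trace_zM Kz tz) // ta.
have tzc : t (z * c) = 0%R by rewrite (trace_zM Kz tz) // tc.
have zazc : (z * a) * (z * c) = a * c.
  by rewrite -(zC _ Ka) -mulgA (mulgA z) z2 mul1g.
have tzac : t ((z * a) * (z * c)) = 0%R by rewrite zazc.
have uz w : u * (z * w) * u^-1 = z * (u * w * u^-1).
  by rewrite !mulgA (zC _ Ku).
apply: (TraceT24 Kza Kzc Ku tza tzc tu tzac).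
- by rewrite uz.
- by rewrite uz -/y ycE mulgA z2 mul1g zazc.
- apply/seteqP; split; first exact: tetrahedral_span.
  by apply: (subgroup_generated_min Ksub) => _ [[->|->]|->].
Qed.

(** If -I and an element w of trace 1 are in K, an element h outside the group of
    w yields an element of trace 0, because t(hw) + t(hw^-1) = t(h) has no
    solution with three odd numbers.  The two remaining cases are whether or not
    K has two orthogonal elements of trace 0. *)
Theorem integral_trace_classification : integral_trace_type.
Proof.
have [[v [Kv tv]]|t_even] :=
    pselect (exists v, K v /\ (t v = 1%R \/ t v = (-1)%R)); last first.
  apply: integral_trace_even => g Kg; split=> tg; apply: t_even; exists g.
    by split=> //; left.
  by split=> //; right.
have [u [Ku tu]] : exists u, K u /\ t u = (-1)%R.
  case: tv => tv; last by exists v.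
  exists (v ^+ 2); split; first exact: KX.
  by have := trace_expS 0 Kv; rewrite expg0 expg1 trace1 tv.
have [[g [Kg tg]]|noz] := pselect (exists g, K g /\ t g = (-2)%R); last first.
  by apply: (integral_trace_no_involution Ku tu) => g Kg tg; apply: noz; exists g.
have gz := integral_trace_eqN2 Kt Kg tg; rewrite gz in Kg tg.
pose w := z * u; have Kw : K w by exact: KM.
have tw : t w = 1%R by rewrite (trace_zM Kg tg Ku) tu.
have [wz _] := trace1_cube Kw tw.
set S := subgroup_generated [set w].
have Ssub : is_subgroup S := subgroup_generated_subgroup _.
have Sw : S w by exact: subset_subgroup_generated.
have Sz : S z by rewrite -wz; exact: (subgroupX Ssub).
have [KS|/existsNP[h /not_implyP[Kh Sh]]] := pselect (K `<=` S).
  apply: (TraceC6 Kw tw); apply/seteqP; split=> //.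
  by apply: (subgroup_generated_min Ksub) => _ ->.
have [i [Ki ti]] : exists i, K i /\ t i = 0%R.
  apply: contrapT => no0.
  have odd_out x k : K x -> K k -> S k -> ~ S x ->
      t (x * k) = 1%R \/ t (x * k) = (-1)%R.
    move=> Kx Kk Sk Sx; have Kxk := KM Kx Kk.
    have [[txk|txk|txk|txk]|txk] := trace_cases Kxk; [|by right| |by left|].
    - by case: Sx; apply: (mem_of_trace Ssub Sz Kx Kk Sk); right.
    - by case: no0; exists (x * k).
    - by case: Sx; apply: (mem_of_trace Ssub Sz Kx Kk Sk); left.
  have e := tM Kh Kw; rewrite tw in e.
  have := odd_out h 1 Kh K1 (subgroup1 Ssub) Sh; rewrite mulg1.
  have := odd_out h w Kh Kw Sw Sh.
  have := odd_out h w^-1 Kh (KV Kw) (subgroupV Ssub Sw) Sh.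
  by trace_lia.
have [[a [b [[Ka Kb] [ta tb tab]]]]|no_pair] := pselect (exists a b,
    (K a /\ K b) /\ [/\ t a = 0%R, t b = 0%R & t (a * b) = 0%R]).
  exact: (integral_trace_tetrahedral Ka Kb ta tb tab Ku tu).
apply: (integral_trace_hexagonal Kw tw Ki ti) => a b Ka Kb ta tb tab.
by apply: no_pair; exists a, b.
Qed.

End IntegralTrace.

(** * Traces of elements of finite order *)

Section SL2Trace.
Local Open Scope ring_scope.

Lemma adj_mx22 (A : comNzRingType) (M : 'M[A]_2) : \adj M = (\tr M)%:M - M.
Proof.
have I2 (i : 'I_2) : i = 0 \/ i = 1.
  by case: i => [[|[|[]]] ?] //; [left|right]; exact: val_inj.
have l0 : lift (0 : 'I_2) 0 = 1 by exact: val_inj.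
have l1 : lift (1 : 'I_2) 0 = 0 by exact: val_inj.
apply/matrixP => i j; rewrite !mxE /cofactor det_mx11 !mxE.
rewrite /mxtrace !big_ord_recl big_ord0 addr0 -[ord0]/(0 : 'I_2) l0.
case: (I2 i) => ->; case: (I2 j) => ->; rewrite ?l0 ?l1 /=.
- by rewrite mul1r mulr1n addrAC subrr add0r.
- by rewrite expr1 mulN1r add0r.
- by rewrite expr1 mulN1r add0r.
- by rewrite -signr_odd mul1r mulr1n addrK.
Qed.

Section CommutativeRing.
Variable A : comNzRingType.
Implicit Types g h : SL2 A.

Lemma SL2_trM g h :
  \tr (g * h)%g + \tr (g * h^-1)%g = \tr g * \tr h.
Proof.
rewrite /= adj_mx22 mulmxBr mul_mx_scalar linearB /=.
by rewrite mxtraceZ addrC subrK mulrC.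
Qed.

Lemma SL2_tr1 : \tr (1%g : SL2 A) = 2.
Proof. by rewrite /= mxtrace1. Qed.

Lemma SL2_Cayley_Hamilton g :
  val g *m val g = \tr g *: val g - 1%:M.
Proof.
have := mul_mx_adj (val g); rewrite (eqP (valP g)) adj_mx22 mulmxBr.
by rewrite mul_mx_scalar => <-; rewrite opprB addrCA subrr addr0.
Qed.

Lemma SL2_opp1M g : val (SL2_opp1 A * g)%g = - val g.
Proof. by rewrite /= mulNmx mul1mx. Qed.

End CommutativeRing.

Section NumField.
Variable F : numFieldType.

(** By Cayley-Hamilton, g - 1 has square zero; so g^k = 1 + k (g - 1), which is 1
    in characteristic 0 only if g = 1 or k = 0. *)
Lemma SL2_finite_order_tr2 (g : SL2 F) n :
  (g ^+ n.+1)%g = 1%g -> \tr g = 2 -> g = 1%g.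
Proof.
move=> gn tg; have CH := SL2_Cayley_Hamilton g; rewrite tg in CH.
have gX k : val (g ^+ k)%g = 1%:M + k%:R *: (val g - 1%:M).
  elim: k => [|k IHk]; first by rewrite expg0 scale0r addr0.
  rewrite expgS /= IHk mulmxDr mulmx1 -scalemxAr mulmxBr mulmx1 CH.
  have -> : 2 *: val g - 1%:M - val g = val g - 1%:M.
    by rewrite scaler_nat mulr2n addrAC addrK.
  rewrite -natr1 scalerDl scale1r (addrC (_ *: _)) addrA (addrC 1%:M).
  by rewrite subrK.
have /esym/eqP := gX n.+1; rewrite gn /= -subr_eq0 addrAC subrr add0r.
rewrite scaler_eq0 pnatr_eq0 /= subr_eq0 => /eqP g1.
exact: val_inj.
Qed.

Lemma SL2_finite_order_trN2 (g : SL2 F) n :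
  (g ^+ n.+1)%g = 1%g -> \tr g = -2 -> g = SL2_opp1 F.
Proof.
move=> gn tg.
have z2 : (SL2_opp1 F * SL2_opp1 F = 1)%g.
  by apply: val_inj; rewrite SL2_opp1M opprK.
have zg : commute (SL2_opp1 F) g.
  by apply: val_inj; rewrite SL2_opp1M /= mulmxN mulmx1.
suff : (SL2_opp1 F * g = 1)%g.
  by move=> zg1; rewrite -[g]mul1g -z2 -mulgA zg1 mulg1.
apply: (@SL2_finite_order_tr2 _ (n.*2.+1)).
  rewrite -doubleS -mul2n expgMn // expgM expg2 z2 expg1n mul1g mulnC expgM.
  by rewrite gn expg1n.
by rewrite SL2_opp1M raddfN /= tg opprK.
Qed.

End NumField.

Section ClosedField.
Variable C : numClosedFieldType.

(** An eigenvalue a is a root of unity, so the other one, its inverse, is its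
    complex conjugate and tr g = a + a^*. *)
Lemma SL2_finite_order_tr (g : SL2 C) n : (g ^+ n.+1)%g = 1%g ->
  \tr g \is Num.real /\ `|\tr g| <= 2.
Proof.
move=> gn.
have /closed_rootP[a] : size (char_poly (val g)) != 1 by rewrite size_char_poly.
rewrite -eigenvalue_root_char => /eigenvalueP[v va v_neq0].
have vX k : v *m val (g ^+ k)%g = a ^+ k *: v.
  elim: k => [|k IHk]; first by rewrite expg0 /= mulmx1 scale1r.
  by rewrite expgSr /= mulmxA IHk -scalemxAl va scalerA -exprSr.
have aE k : a ^+ k *: v = v -> a ^+ k = 1.
  move/eqP; rewrite -subr_eq0 -{2}[v]scale1r -scalerBl scaler_eq0.
  by rewrite (negbTE v_neq0) orbF subr_eq0 => /eqP.
have an : a ^+ n.+1 = 1 by apply: aE; rewrite -vX gn /= mulmx1.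
have a_norm : `|a| = 1.
  by apply/eqP; rewrite -(@pexpr_eq1 _ _ n.+1) // -normrX an normr1.
have aJ : a * a^* = 1 by rewrite -normCK a_norm expr1n.
have a_neq0 : a != 0 by rewrite -normr_eq0 a_norm oner_eq0.
have tE : \tr g = a + a^*.
  have : v *m (val g *m val g) = v *m (\tr g *: val g - 1%:M).
    by rewrite SL2_Cayley_Hamilton.
  rewrite mulmxA va -scalemxAl va mulmxBr -scalemxAr va mulmx1 !scalerA.
  rewrite -[X in _ - X]scale1r -scalerBl => /eqP.
  rewrite -subr_eq0 -scalerBl scaler_eq0 (negbTE v_neq0) orbF subr_eq0.
  move=> /eqP aa; apply: (mulIf a_neq0).
  by rewrite mulrDl aa (mulrC (a^*)) aJ subrK.
split; first by rewrite tE CrealE rmorphD /= conjCK addrC.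
by rewrite tE (le_trans (ler_normD _ _)) // norm_conjC a_norm.
Qed.

End ClosedField.

End SL2Trace.

(** Otherwise the powers of g would be pairwise distinct. *)
Lemma finite_subgroup_order (G : groupType) (K : set G) (g : G) :
  is_subgroup K -> finite_set K -> K g -> exists n, g ^+ n.+1 = 1.
Proof.
move=> Ksub Kfin Kg; apply: contrapT => no_order.
apply: infinite_nat; rewrite -[setT](_ : (fun n => g ^+ n) @^-1` K = _).
  apply: finite_preimage Kfin => m n _ _ /=.
  wlog mn : m n / (m <= n)%N => [hw|gmn].
    by case: (leqP m n) => [/hw//|/ltnW/hw h /esym/h].
  case: (posnP (n - m)) => [/eqP|n_gt0].
    by rewrite subn_eq0 => nm; apply/eqP; rewrite eqn_leq mn.
  case: no_order; exists (n - m).-1; rewrite prednK //.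
  by apply: (mulgI (g ^+ m)); rewrite -expgD subnKC // mulg1.
by apply/seteqP; split=> // n _; exact: subgroupX.
Qed.

(** * Endomorphism rings of complex tori *)

Section EndomorphismRing.
Variable T : realType.
Local Notation C := (T[i]).
Local Open Scope ring_scope.
Import numFieldNormedType.Exports.

(** Otherwise phi takes the value m + 1/2, where m is the smaller of the integers
    phi 0 and phi 1. *)
Lemma integer_valued_continuous (phi : T -> T) : continuous phi ->
  (forall s, exists m : int, phi s = m%:~R) -> phi 1 = phi 0.
Proof.
move=> phi_cont phi_int; apply: contrapT => phi01.
have [m0 phi0] := phi_int 0; have [m1 phi1] := phi_int 1.
pose m := Num.min m0 m1.
have mm : m0 != m1 by apply/eqP => mm; apply: phi01; rewrite phi0 phi1 mm.
have [||c _ phic] := @IVT T phi 0 1 (m%:~R + 2^-1) ler01.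
- exact: continuous_subspaceT.
- have half : 0 <= (2^-1 : T) <= 1 by rewrite invr_ge0 ler0n invf_le1 ?ler1n ?ltr0n.
  have [half0 half1] := andP half.
  rewrite phi0 phi1 /m ge_min le_max.
  have [m01|m10] := leP m0 m1.
    rewrite lerDl half0 /=; apply/orP; right.
    by rewrite (le_trans (lerD (lexx _) half1)) // -intrD1 ler_int; lia.
  rewrite lerDl half0 orbT /=; apply/orP; left.
  by rewrite (le_trans (lerD (lexx _) half1)) // -intrD1 ler_int; lia.
have [k phik] := phi_int c; rewrite phik in phic.
have mk : (m < k)%R by rewrite -(ltr_int T) phic ltrDl invr_gt0 ltr0n.
have km : (k < m + 1)%R.
  by rewrite -(ltr_int T) phic intrD1 ltrD2l invf_lt1 ?ltr0n // ltr1n.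
lia.
Qed.

Lemma continuous_Im_line (F : C^o -> C^o) (z w c : C) : continuous F ->
  continuous (fun s : T => complex.Im (F (s%:C%C * z + w) * c) : T).
Proof.
move=> F_cont s0; apply/cvgrPdist_lt => e e_gt0.
have normE (x : C) : `|x| = (complex.Re `|x|)%:C%C by rewrite normc_def.
have norm_ge0 (x : C) : 0 <= complex.Re `|x| by rewrite -ler0c -normE.
have norm_real (x : T) : `|x%:C%C| = `|x|%:C%C.
  by rewrite normc_def /= expr0n /= addr0 sqrtr_sqr.
have c1_gt0 : 0 < `|c| + 1 :> C by rewrite ltr_wpDl.
have z1_gt0 : 0 < complex.Re `|z| + 1 by rewrite ltr_wpDl.
have e'_gt0 : 0 < e%:C%C / (`|c| + 1) :> C by rewrite divr_gt0 // ltcR.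
have /cvgrPdist_lt/(_ _ e'_gt0)/nbhs_ballP[d /= d_gt0 Fd] := F_cont (s0%:C%C * z + w).
have dE : d = (complex.Re d)%:C%C by rewrite RRe_real // gtr0_real.
have d'_gt0 : 0 < complex.Re d by rewrite -ltcR -dE.
have r_gt0 : 0 < complex.Re d / (complex.Re `|z| + 1) by rewrite divr_gt0.
near=> s.
have s_near : `|s0 - s| < complex.Re d / (complex.Re `|z| + 1).
  by near: s; apply/nbhs_ballP; exists (complex.Re d / (complex.Re `|z| + 1)).
have Fs : `|F (s0%:C%C * z + w) - F (s%:C%C * z + w)| < e%:C%C / (`|c| + 1).
  apply: Fd; rewrite -ball_normE /ball_ /= opprD addrACA subrr addr0 -mulrBl -rmorphB.
  rewrite normrM norm_real (normE z) dE -rmorphM ltcR.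
  rewrite (le_lt_trans (_ : _ <= `|s0 - s| * (complex.Re `|z| + 1))) //.
    by rewrite ler_wpM2l // lerDl.
  by rewrite -ltr_pdivlMr.
rewrite -raddfB -mulrBl -ltcR.
apply: (@le_lt_trans _ _ (`|F (s0%:C%C * z + w) - F (s%:C%C * z + w)| * `|c|)).
  rewrite -normrM [X in _ <= X]normc_def lecR -sqrtr_sqr ler_wsqrtr //.
  by rewrite lerDr sqr_ge0.
apply: (@le_lt_trans _ _ (`|F (s0%:C%C * z + w) - F (s%:C%C * z + w)| * (`|c| + 1))).
  by rewrite ler_wpM2l // lerDl.
by rewrite -ltr_pdivlMr.
Unshelve. all: by end_near.
Qed.

(** The imaginary part of w1 w2^* is the signed area of a fundamental
    parallelogram. *)
Lemma lattice_coordinates (L : set C) : is_lattice L ->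
  exists w1 w2 : C, (w1 * w2^*)%R \isn't Num.real /\
    L = [set z | exists m n : int, z = m%:~R * w1 + n%:~R * w2].
Proof.
move=> [w1 [w2 [w_free LE]]]; exists w1, w2; split=> //; apply/negP => w12.
have w22 : w2 * w2^* = (complex.Re (w2 * w2^*))%:C%C.
  by rewrite RRe_real // -normCK rpredX // normr_real.
have dep : (complex.Re (w2 * w2^*))%:C%C * w1
           + (- complex.Re (w1 * w2^*))%:C%C * w2 = 0.
  by rewrite rmorphN /= -w22 RRe_real // mulNr [X in X - _]mulrC (mulrC w2) mulrA subrr.
have [w20 _] := w_free _ _ dep.
have w2_eq0 : w2 = 0.
  by apply/eqP; rewrite -normr_eq0 -sqrf_eq0 normCK w22 w20.
have [_ /eqP] : (0 : T) = 0 /\ (1 : T) = 0.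
  by apply: w_free; rewrite w2_eq0 mul0r mulr0 addr0.
by rewrite oner_eq0.
Qed.

(** The coordinates of D are integers, and they are continuous real functions on
    the segment from 0 to z: up to the area of a fundamental parallelogram they
    are the imaginary parts of D w2^* and D w1^*. *)
Lemma lattice_valued_continuous (L : set C) (D : C^o -> C^o) (z : C) :
  is_lattice L -> continuous D -> (forall x, L (D x)) -> D z = D 0.
Proof.
move=> /lattice_coordinates[w1 [w2 [w12 ->]]] D_cont DL.
have ImE (x : C) : x \is Num.real = (complex.Im x == 0).
  by case: x => a b; rewrite complex_real.
have Im12 : complex.Im (w1 * w2^*) != 0 by rewrite -ImE.
have Im21 : complex.Im (w2 * w1^*) != 0.
  by rewrite -ImE -[w2]conjCK -rmorphM mulrC /= CrealJ.
have ImZ (m : int) (x : C) : complex.Im (m%:~R * x) = m%:~R * complex.Im x.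
  by rewrite mulrzl raddfMz /= mulrzl.
have ImD (x y : C) : complex.Im (x + y) = complex.Im x + complex.Im y.
  exact: raddfD.
have ImB (x y : C) : complex.Im (x - y) = complex.Im x - complex.Im y.
  exact: raddfB.
have Im0 (x : C) : complex.Im (x * x^*) = 0.
  by apply/eqP; rewrite -ImE -normCK rpredX // normr_real.
have coord c : (forall m n : int, exists k : int,
    complex.Im ((m%:~R * w1 + n%:~R * w2) * c) / complex.Im (w1 * w2^*) = k%:~R) ->
  complex.Im (D z * c) = complex.Im (D 0 * c).
  move=> c_int.
  have := @integer_valued_continuous
    (fun s : T => complex.Im (D (s%:C%C * z + 0) * c) / complex.Im (w1 * w2^*)).
  rewrite !addr0 mul1r mul0r => e; apply: (mulIf (invr_neq0 Im12)); apply: e.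
    move=> s; apply: cvgM; last exact: cvg_cst.
    exact: (@continuous_Im_line D z 0 c D_cont s).
  move=> s; have [m [n ->]] := DL (s%:C%C * z + 0); exact: c_int.
have Imeq : complex.Im ((D z - D 0) * w1^*) = 0 /\ complex.Im ((D z - D 0) * w2^*) = 0.
  rewrite !mulrBl !ImB; split; apply/eqP; rewrite subr_eq0; apply/eqP; apply: coord => m n.
    exists (- n); rewrite mulrDl -!mulrA ImD !ImZ Im0 mulr0 add0r.
    have -> : complex.Im (w2 * w1^*) = - complex.Im (w1 * w2^*).
      by rewrite -[w2 in LHS]conjCK -rmorphM [w2^* * _]mulrC; case: (w1 * w2^*).
    by rewrite mulrN mulNr mulfK // rmorphN.
  by exists m; rewrite mulrDl -!mulrA ImD !ImZ Im0 mulr0 addr0 mulfK.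
have [m [n Dz]] := DL z; have [m' [n' D0]] := DL 0.
have DE : D z - D 0 = (m - m')%:~R * w1 + (n - n')%:~R * w2.
  by rewrite Dz D0 !rmorphB /= !mulrBl opprD addrACA.
move: Imeq; rewrite DE !mulrDl -!mulrA !ImD !ImZ !Im0 !mulr0 add0r addr0.
move=> [/eqP + /eqP]; rewrite !mulf_eq0 (negbTE Im12) (negbTE Im21) !orbF !intr_eq0.
move=> /eqP nn /eqP mm; apply/eqP; rewrite -subr_eq0 DE nn mm !mul0r addr0.
exact: eqxx.
Qed.

Lemma continuous_add_defect (K : numFieldType) (V W : normedModType K)
    (F : V -> W) (y : V) :
  continuous F -> continuous (fun x => F (x + y) - (F x + F y)).
Proof.
move=> F_cont x; apply: cvgB; last by apply: cvgD; [exact: F_cont|exact: cvg_cst].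
apply: (@continuous_comp _ _ _ (fun x => x + y)); last exact: F_cont.
by apply: cvgD; [exact: cvg_id|exact: cvg_cst].
Qed.

Lemma is_derive_quotient (K : numFieldType) (f : K^o -> K^o) (a e : K) :
  is_derive (0 : K^o) 1 f a -> 0 < e -> exists2 d : K, 0 < d &
    forall h, h != 0 -> `|h| < d -> `|h^-1 * (f h - f 0) - a| < e.
Proof.
move=> f_der e_gt0.
have : h^-1 *: ((f \o shift (0 : K^o)) (h *: (1 : K^o)) - f 0)
    @[h --> (0 : K)^'] --> (a : K^o).
  by case: f_der => f_der <-; exact: f_der.
move/cvgrPdistC_lt/(_ _ e_gt0).
rewrite /dnbhs /within /= => /nbhs_ballP[d /= d_gt0 ball_d].
exists d => // h h_neq0 h_d.
have := ball_d h; rewrite -ball_normE /ball_ /= sub0r normrN => /(_ h_d h_neq0).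
by rewrite addr0 [_%:A]mulr1.
Qed.

(** The lift F satisfies F(x + y) - F(x) - F(y) = - F(0) by discreteness of L, so
    that E = F - F(0) is additive.  The quotient E(h)/h takes the same value at
    all points h = z/n, and its limit at 0 is a; hence E(z) = a z, and E maps L
    to itself. *)
Lemma endomorphism_ring_mulL (L : set C) (a w : C) : is_lattice L ->
  endomorphism_ring L a -> L w -> L (a * w).
Proof.
move=> L_lattice [F [[F_der FL F_add] F0]] Lw.
have F_cont : continuous F.
  by move=> x; apply/differentiable_continuous/derivable1_diffP.
have addF (z y : C) : F (z + y) =  F z + F y - F 0.
  pose D x := F (x + y) - (F x + F y).
  have D_cont : continuous (D : C^o -> C^o).
    exact: (@continuous_add_defect _ C^o C^o F y F_cont).
  have := lattice_valued_continuous z L_lattice D_cont (fun x => F_add x y).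
  rewrite /D add0r (addrC (F 0)) [in RHS]opprD [in RHS]addrA subrr add0r => /eqP.
  by rewrite subr_eq => /eqP->; rewrite addrC.
pose E (z : C) : C := F z - F 0.
have EM (z : C) n : E (z *+ n) = E z *+ n.
  elim: n => [|n IHn]; first by rewrite !mulr0n /E subrr.
  by rewrite !mulrS -IHn /E addF [RHS]addrACA addrA.
have EE (z : C) : E z = a * z.
  have [->|z0] := eqVneq z 0; first by rewrite /E subrr mulr0.
  apply/eqP; rewrite -subr_eq0 -(divfK z0 (E z)) -mulrBl mulf_eq0 (negbTE z0) orbF.
  rewrite -normr_eq0; apply: contraT => ne; exfalso.
  have ne0 : 0 < `|E z / z - a| by rewrite lt_def ne normr_ge0.
  have [d d_gt0 quotient_d] := is_derive_quotient F0 ne0.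
  have dE : d = (complex.Re d)%:C%C by rewrite RRe_real // gtr0_real.
  have d'_gt0 : 0 < complex.Re d by rewrite -ltcR -dE.
  have zE : `|z| = (complex.Re `|z|)%:C%C by rewrite normc_def.
  have z'_ge0 : 0 <= complex.Re `|z| by rewrite -ler0c -zE.
  pose n := Num.bound (complex.Re `|z| / complex.Re d).
  have n_big : complex.Re `|z| / complex.Re d < n%:R.
    by apply: archi_boundP; rewrite divr_ge0 // ltW.
  have n_gt0 : (0 : T) < n%:R by rewrite (le_lt_trans _ n_big) // divr_ge0 // ltW.
  have n_neq0 : n%:R != 0 :> C by rewrite pnatr_eq0 -lt0n -(ltr0n T).
  have h_neq0 : z / n%:R != 0 by rewrite mulf_neq0 // invr_neq0.
  have := quotient_d (z / n%:R) h_neq0; rewrite -/(E _).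
  have -> : (z / n%:R)^-1 * E (z / n%:R) = E z / z.
    have -> : E z = E (z / n%:R) * n%:R.
      by rewrite mulr_natr -EM -(mulr_natr (z / n%:R)) divfK.
    by rewrite invf_div mulrC mulrA.
  rewrite ltxx => /(_ _)/negP; apply => //.
  rewrite normrM normfV normr_nat.
  rewrite ltr_pdivrMr ?ltr0n ?lt0n -?(pnatr_eq0 C) // zE dE.
  rewrite -(rmorph_nat (real_complex T)) -rmorphM ltcR.
  by rewrite mulrC -ltr_pdivrMr.
have := FL w 0; rewrite subr0 => /(_ Lw).
by rewrite -/(E w) EE.
Qed.

(** Write a w1 = m w1 + n w2; as a is real, the independence of w1 and w2 over the
    reals gives a = m. *)
Lemma real_lattice_multiplier (L : set C) (a : C) : is_lattice L ->
  (forall w, L w -> L (a * w)) -> a \is Num.real -> exists m : int, a = m%:~R.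
Proof.
move=> [w1 [w2 [w_free LE]]] aL a_real.
have Lw1 : L w1 by rewrite LE; exists 1, 0; rewrite mul1r mul0r addr0.
have := aL _ Lw1; rewrite {1}LE => -[m [n aw1]]; exists m.
have [] := w_free (complex.Re a - m%:~R) (- n%:~R).
  rewrite rmorphB rmorphN /= !rmorph_int RRe_real // mulrBl aw1.
  by rewrite [_ * w1 + _]addrC addrK mulNr subrr.
by move/eqP; rewrite subr_eq0 => /eqP am _; rewrite -(RRe_real a_real) am rmorph_int.
Qed.

End EndomorphismRing.

(** * Finite models and concrete groups *)

(** The presentation of the dicyclic group and the standard quaternion group live
    on types with finitely many elements; this copy brings a finite subgroup of
    an infinite group there. *)
Lemma finite_subgroup_model (G : groupType) (K : set G) :
  is_subgroup K -> finite_set K ->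
  exists (gT : finGroupType) (e : gT -> G),
    [/\ injective e, {morph e : x y / x * y} & range e = K].
Proof.
move=> Ksub /finite_fsetP[A KE].
have memA x : x \in A <-> K x by rewrite KE.
pose A' : finType := A.
have A1 : 1 \in A by apply/memA; exact: (subgroup1 Ksub).
have AM (x y : A') : val x * val y \in A.
  by apply/memA/(subgroupM Ksub); apply/memA; exact: valP.
have AV (x : A') : (val x)^-1 \in A.
  by apply/memA/(subgroupV Ksub)/memA; exact: valP.
pose mul (x y : A') : A' := Sub (val x * val y) (AM x y).
pose one : A' := Sub 1 A1.
pose inv (x : A') : A' := Sub (val x)^-1 (AV x).
have mulA : associative mul by move=> x y z; apply: val_inj; rewrite /= mulgA.
have mul1 : left_id one mul by move=> x; apply: val_inj; rewrite /= mul1g.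
have mulr1 : right_id one mul by move=> x; apply: val_inj; rewrite /= mulg1.
have mulV : left_inverse one inv mul by move=> x; apply: val_inj; rewrite /= mulVg.
have mulrV : right_inverse one inv mul by move=> x; apply: val_inj; rewrite /= mulgV.
pose gT : finGroupType := HB.pack (A' : Type) (Finite.class A')
  (isGroup.Build A' mulA mul1 mulr1 mulV mulrV).
exists gT, (fun x : A' => val x); split => //.
apply/seteqP; split=> [_ [x _ <-]|x /memA Ax]; first by apply/memA; exact: valP.
by exists (Sub x Ax : A').
Qed.

Lemma isomorphic_refl (G : groupType) (K : set G) : isomorphic K K.
Proof.
exists id; split=> //; split=> [x Kx|x y _ _|x Kx] //=; by exists x.
Qed.

Lemma isomorphic_trans (G1 G2 G3 : groupType) (K1 : set G1) (K2 : set G2)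
    (K3 : set G3) : isomorphic K1 K2 -> isomorphic K2 K3 -> isomorphic K1 K3.
Proof.
move=> [f [fM [fK fI fS]]] [g [gM [gK gI gS]]]; exists (g \o f).
have fmem x : x \in K1 -> f x \in K2.
  by move=> /set_mem Kx; apply/mem_set/fK.
split=> [x y Kx Ky|] /=; first by rewrite fM // gM // fmem.
split=> [x /fK/gK //|x y Kx Ky /gI|x Kx].
  by move=> /(_ (fmem _ Kx) (fmem _ Ky)); exact: fI.
by have [y Ky <-] := gS x Kx; have [w Kw <-] := fS y Ky; exists w.
Qed.

Lemma isog_isomorphic (gT rT : finGroupType) :
  [set: gT]%G \isog [set: rT]%G -> isomorphic (@setT gT) (@setT rT).
Proof.
move=> /isogP[f f_inj fT]; exists f; split.
  by move=> x y _ _; rewrite morphM ?inE.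
split=> // [x y _ _|y _]; first by move/injmP: f_inj => /(_ x y); rewrite !inE => /(_ isT isT).
have : y \in f @* [set: gT]%SET by rewrite fT inE.
by move=> /morphimP[x _ _ ->]; exists x.
Qed.

Lemma group_is_subgroup (gT : finGroupType) (H : {group gT}) :
  is_subgroup [set` H].
Proof.
apply: is_subgroupP => /=; first exact: group1.
- by move=> x y; exact: groupM.
- by move=> x; rewrite groupV.
Qed.

Lemma Zp_isomorphic (G : groupType) (g : G) n : has_order g n.+2 ->
  isomorphic (subgroup_generated [set g]) (@setT 'Z_n.+2).
Proof.
move=> og; have gn : g ^+ n.+2 = 1 by apply/og.
have o1 : has_order (Zp1 : 'Z_n.+2) n.+2.
  move=> i; have -> : (n.+2 %| i)%N = (Zp1 ^+ i == 1 :> 'Z_n.+2)%g.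
    by rewrite -order_dvdn order_Zp1.
  by split=> [->|/eqP].
rewrite (subgroup_generated1 gn).
have -> : @setT 'Z_n.+2 = range (fun i : nat => (Zp1 : 'Z_n.+2) ^+ i).
  apply/seteqP; split=> // x _; exists (x : nat) => //; exact: Zp1_expgz.
exact: cyclic_isomorphic.
Qed.

Lemma dicyclic_model (G : groupType) n (a b : G) :
  (1 < n)%N -> dicyclic_rel n a b -> has_order a n.*2 ->
  finite_set (subgroup_generated [set a; b]) ->
  exists (gT : finGroupType) (c d : gT),
    [/\ dicyclic_rel n c d, has_order c n.*2 &
        subgroup_generated [set c; d] = setT].
Proof.
move=> n_gt1 ab_rel oa K_fin; have n_gt0 := ltnW n_gt1.
have [gT [e [e_inj eM eK]]] :=
  finite_subgroup_model (subgroup_generated_subgroup _) K_fin.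
have [c _ ca] : range e a.
  by rewrite eK; apply: subset_subgroup_generated; left.
have [d _ db] : range e b.
  by rewrite eK; apply: subset_subgroup_generated; right.
have e1 : e 1 = 1 by apply: (mulgI (e 1)); rewrite -eM !mulg1.
have eX x m : e (x ^+ m) = e x ^+ m.
  by elim: m => [|m IHm]; rewrite ?expg0 // !expgS eM IHm.
have cd_rel : dicyclic_rel n c d.
  by have [b2 aba] := ab_rel; split; apply: e_inj; rewrite ?eM ?eX ca db.
exists gT, c, d; split=> //.
  move=> i; split=> [ci|/oa ai]; first by apply/oa; rewrite -ca -eX ci.
  by apply: e_inj; rewrite eX ca e1.
apply/seteqP; split=> // x _.
have : range e (e x) by exists x.
rewrite eK (dicyclic_generated ab_rel n_gt0) (dicyclic_generated cd_rel n_gt0).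
move=> [ij _ ijx]; exists ij => //; apply: e_inj.
by rewrite -ijx /dicyclic_nf eM !eX ca db.
Qed.

Lemma dicyclic_Grp (gT : finGroupType) n (a b : gT) : (1 < n)%N ->
  dicyclic_rel n a b -> has_order a n.*2 ->
  subgroup_generated [set a; b] = setT -> dicyclic n [set: gT]%G.
Proof.
move=> n_gt1 ab_rel oa abT; have [b2 aba] := ab_rel.
have genT : <[a]> <*> <[b]> = [set: gT]%SET.
  apply/setP => x; rewrite inE.
  have : subgroup_generated [set a; b] x by rewrite abT.
  apply: (subgroup_generated_min (group_is_subgroup (<[a]> <*> <[b]>)%G)).
  move=> _ [->|->] /=; rewrite mem_gen // inE ?cycle_id ?orbT //.
apply: intro_isoGrp.
  apply/existsP; exists (a, b); rewrite /= !xpair_eqE genT eqxx /=.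
  rewrite (dicyclic_a2n ab_rel) b2 !eqxx /= conjgE.
  by apply/eqP; apply: (mulIg a); rewrite mulVg -2!mulgA (mulgA a) aba mulVg.
move=> rT H /existsP[[c d]] /=; rewrite !xpair_eqE /=.
move=> /and4P[/eqP HE /eqP cn /eqP d2 /eqP cd].
have cd_rel : dicyclic_rel n c d.
  split=> //; apply: (mulgI d^-1); rewrite mulVg !mulgA.
  by move: cd; rewrite conjgE !mulgA => ->; rewrite mulVg.
have [f [fM fa fb]] := dicyclic_morphism n_gt1 ab_rel oa cd_rel.
rewrite abT in fM.
have fM' : {in [set: gT]%SET &, {morph f : x y / x * y}}.
  by move=> x y _ _; apply: fM; rewrite in_setT.
pose F := Morphism fM'; apply/homgP; exists F.
have -> : F @* [set: gT]%SET = F @* (<[a]> <*> <[b]>) by rewrite genT.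
rewrite morphimY; [|exact: finset.subsetT..].
by rewrite !morphim_cycle ?inE //= fa fb.
Qed.

(** A finite copy of the group and the standard quaternion group have the same
    presentation, so each is a quotient of the other. *)
Lemma quaternion_isomorphic (G : groupType) (a b : G) :
  dicyclic_rel 2 a b -> has_order a 4 ->
  finite_set (subgroup_generated [set a; b]) ->
  isomorphic (subgroup_generated [set a; b]) (@setT 'Q_8).
Proof.
move=> ab_rel oa K_fin.
have [gT [c [d [cd_rel oc cdT]]]] := @dicyclic_model _ 2 _ _ isT ab_rel oa K_fin.
have gTGrp := @dicyclic_Grp _ 2 _ _ isT cd_rel oc cdT.
have QGrp := @Grp_quaternion 3 isT.
apply: (@isomorphic_trans _ _ _ _ (@setT gT)).
  by rewrite -cdT; exact: (@dicyclic_isomorphic 2).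
apply: isog_isomorphic; rewrite isogEhom gTGrp; apply/andP; split.
  by rewrite QGrp; exact: isoGrp_hom gTGrp.
exact: isoGrp_hom QGrp.
Qed.

(** * The group SL(2, 3) *)

Section SL2F3.
Local Open Scope ring_scope.

Definition mx22 (A : comNzRingType) (p q r s : A) : 'M[A]_2 :=
  \matrix_(i < 2, j < 2)
    if i == 0 then (if j == 0 then p else q) else (if j == 0 then r else s).

Lemma mx22_mul (A : comNzRingType) (p q r s p' q' r' s' : A) :
  mx22 p q r s *m mx22 p' q' r' s'
  = mx22 (p * p' + q * r') (p * q' + q * s')
         (r * p' + s * r') (r * q' + s * s').
Proof.
apply/matrixP => i j; rewrite !mxE !big_ord_recl big_ord0 addr0 !mxE /=.
by case: (i == 0); case: (j == 0).
Qed.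

Lemma mx22_det (A : comNzRingType) (p q r s : A) :
  \det (mx22 p q r s) = p * s - q * r.
Proof.
rewrite (expand_det_row _ 0) !big_ord_recl big_ord0 addr0 /cofactor !det_mx11.
by rewrite !mxE /= expr0 expr1 mul1r mulN1r mulrN.
Qed.

Lemma mx22_eta (A : comNzRingType) (M : 'M[A]_2) :
  M = mx22 (M 0 0) (M 0 1) (M 1 0) (M 1 1).
Proof.
apply/matrixP => i j; rewrite !mxE.
by case: i => [[|[|[]]] ?] //; case: j => [[|[|[]]] ?] //=;
  congr (M _ _); exact: val_inj.
Qed.

Lemma mx22_1 (A : comNzRingType) : 1%:M = mx22 1 0 0 1 :> 'M[A]_2.
Proof. by rewrite [LHS]mx22_eta !mxE. Qed.

Lemma F3P (x : 'F_3) : [\/ x = 0, x = 1 | x = -1].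
Proof.
by case: x => [[|[|[|]]]] // ?; [constructor 1|constructor 2|constructor 3];
  exact: val_inj.
Qed.

Lemma F3_i_subproof : \det (mx22 0 (-1) 1 0 : 'M['F_3]_2) == 1.
Proof. by rewrite mx22_det. Qed.
Definition F3_i : SL2 'F_3 := MkSL2 F3_i_subproof.

Lemma F3_j_subproof : \det (mx22 1 1 1 (-1) : 'M['F_3]_2) == 1.
Proof. by rewrite mx22_det. Qed.
Definition F3_j : SL2 'F_3 := MkSL2 F3_j_subproof.

Lemma F3_u_subproof : \det (mx22 1 1 0 1 : 'M['F_3]_2) == 1.
Proof. by rewrite mx22_det. Qed.
(** A transvection, of order 3; conjugation by it maps [F3_i] to [F3_j], and
    [F3_j] to [F3_i * F3_j]. *)
Definition F3_u : SL2 'F_3 := MkSL2 F3_u_subproof.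

Let eq_mx22 (p q r s p' q' r' s' : 'F_3) :
  [&& p == p', q == q', r == r' & s == s'] -> mx22 p q r s = mx22 p' q' r' s'.
Proof. by move=> /and4P[/eqP-> /eqP-> /eqP-> /eqP->]. Qed.

Let opp1E : val (SL2_opp1 'F_3) = mx22 (-1) 0 0 (-1).
Proof. by rewrite /= [LHS]mx22_eta !mxE /= oppr0. Qed.

Lemma F3_relations : SL2F3_relations [:: SL2_opp1 'F_3; F3_i; F3_j; F3_u].
Proof.
have conj (x y w : SL2 'F_3) : (w * x = y * w -> w * x * w^-1 = y)%g.
  by move=> ->; rewrite mulgK.
split; first split.
- apply: val_inj; rewrite opp1E expg2 /= mx22_mul; exact: eq_mx22.
- apply: val_inj; rewrite opp1E expg2 /= mx22_mul; exact: eq_mx22.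
- by apply: val_inj; rewrite (expgS _ 2) expg2 /= !mx22_mul mx22_1; exact: eq_mx22.
- apply: val_inj.
  rewrite -[RHS]/(val (SL2_opp1 'F_3) *m (val F3_i *m val F3_j)) opp1E /=.
  by rewrite !mx22_mul; exact: eq_mx22.
- by apply: conj; apply: val_inj; rewrite /= !mx22_mul; exact: eq_mx22.
- by apply: conj; apply: val_inj; rewrite /= !mx22_mul; exact: eq_mx22.
Qed.

Lemma F3_opp1_neq1 : SL2_opp1 'F_3 <> 1%g.
Proof. by move=> /(congr1 (fun g : SL2 'F_3 => g 0 0)); rewrite /= !mxE. Qed.

(** Bruhat decomposition: up to sign, a matrix with lower left entry 1 is U V W
    with U, W upper unipotent and V = [F3_i], and one with lower left entry 0 is
    upper unipotent, for the only units are 1 and -1.  The upper unipotent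
    matrices are the powers of [F3_u]. *)
Lemma F3_generated : subgroup_generated [set F3_i; F3_j; F3_u] = setT.
Proof.
set S := subgroup_generated _.
have Ssub : is_subgroup S := subgroup_generated_subgroup _.
have Si : S F3_i by apply: subset_subgroup_generated; left; left.
have Su : S F3_u by apply: subset_subgroup_generated; right.
have uX n : val (F3_u ^+ n)%g = mx22 1 n%:R 0 1.
  elim: n => [|n IHn]; first by rewrite expg0 /= mx22_1.
  rewrite expgS /= IHn mx22_mul; congr mx22; rewrite ?mul1r ?mulr1 ?mul0r ?mulr0;
    by rewrite ?add0r ?addr0 // natr1.
have unip x : exists2 U : SL2 'F_3, S U & val U = mx22 1 x 0 1.
  exists (F3_u ^+ (x : nat))%g; first exact: (subgroupX Ssub).
  by rewrite uX natr_Zp.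
have Sz : S (SL2_opp1 'F_3).
  have [[<- _] _ _ _ _] := F3_relations; exact: (subgroupX Ssub).
have key (h g : SL2 'F_3) : S h -> val g = val h \/ val g = - val h -> S g.
  move=> Sh [/val_inj->//|gh].
  have -> : g = (SL2_opp1 'F_3 * h)%g by apply: val_inj; rewrite SL2_opp1M.
  exact: (subgroupM Ssub).
apply/seteqP; split=> // g _.
have gE := mx22_eta (val g).
have g_det := eqP (valP g); rewrite {1}gE mx22_det in g_det.
move: (val g 0 0) (val g 0 1) (val g 1 0) (val g 1 1) gE g_det => p q r s gE g_det.
have big_cell p' s' : exists2 h : SL2 'F_3, S h & val h = mx22 p' (p' * s' - 1) 1 s'.
  have [U SU UE] := unip p'; have [V SV VE] := unip s'.
  exists (U * F3_i * V)%g; first by do 2![apply: (subgroupM Ssub) => //].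
  rewrite /= UE VE !mx22_mul; congr mx22;
    by rewrite !(mul0r, mul1r, mulr0, mulr1, add0r, addr0).
have oppE (a b c d : 'F_3) : - mx22 a b c d = mx22 (- a) (- b) (- c) (- d).
  by rewrite [LHS]mx22_eta !mxE.
have [r0|r1|rN1] := F3P r.
- have [U SU UE] := unip (p * q); apply: (key _ _ SU).
  rewrite gE UE r0 oppE oppr0; rewrite r0 mulr0 subr0 in g_det.
  have [pE|pE|pE] := F3P p; rewrite pE in g_det *.
  + by move: g_det; rewrite mul0r => /eqP; rewrite eq_sym oner_eq0.
  + by left; rewrite mul1r -g_det !mul1r.
  + have sE : s = -1 by rewrite -[s]opprK -[in LHS](mulN1r s) g_det.
    by right; rewrite sE mulN1r opprK.
- have [h Sh hE] := big_cell p s; apply: (key _ _ Sh); left.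
  have qE : q = p * s - 1 by rewrite -g_det opprB addrCA subrr addr0 r1 mulr1.
  by rewrite gE hE r1 -qE.
- have [h Sh hE] := big_cell (- p) (- s); apply: (key _ _ Sh); right.
  have qE : - q = - p * - s - 1.
    by rewrite -g_det mulrNN opprB addrCA subrr addr0 rN1 mulrN1.
  by rewrite gE hE -qE oppE rN1 !opprK.
Qed.

End SL2F3.

(** * Finite subgroups of SL(2) over the endomorphism ring *)

Lemma lattice_multiplier_tr (T : realType) (L : set T[i]) (g : SL2 T[i]) :
  is_lattice L -> SL2_over (endomorphism_ring L) g -> (\tr g)%R \is Num.real ->
  exists m : int, (\tr g = m%:~R)%R.
Proof.
move=> L_lattice gR; apply: (real_lattice_multiplier L_lattice) => w Lw.
have [w1 [w2 [_ LE]]] := L_lattice.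
have LD x y : L x -> L y -> L (x + y)%R.
  rewrite LE => -[m [n ->]] [m' [n' ->]]; exists (m + m')%R, (n + n')%R.
  by rewrite !intrD !mulrDl addrACA.
have -> : (\tr g * w = g ord0 ord0 * w + g (lift ord0 ord0) (lift ord0 ord0) * w)%R.
  by rewrite /mxtrace !big_ord_recl big_ord0 addr0 mulrDl.
by apply: LD; exact: (endomorphism_ring_mulL L_lattice (gR _ _) Lw).
Qed.

Lemma finite_subgroup_integral_trace (T : realType) (L : set T[i])
    (K : set (SL2 T[i])) : is_lattice L -> is_subgroup K -> finite_set K ->
  K `<=` SL2_over (endomorphism_ring L) ->
  exists2 t : SL2 T[i] -> int, integral_trace K (SL2_opp1 T[i]) t &
    forall g, K g -> (\tr g = (t g)%:~R)%R.
Proof.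
move=> L_lattice Ksub Kfin KR.
pose t (g : SL2 T[i]) : int := xget 0%R [set m : int | (\tr g = m%:~R)%R].
have tE g : K g -> (\tr g = (t g)%:~R)%R.
  move=> Kg; have [n gn] := finite_subgroup_order Ksub Kfin Kg.
  have [tr_real _] := SL2_finite_order_tr gn.
  have [m gm] := lattice_multiplier_tr L_lattice (KR _ Kg) tr_real.
  by rewrite /t; case: xgetP => [k _ //|/(_ m)]; case.
exists t => //.
split=> //.
- move=> g h Kg Kh; apply: (@intr_inj T[i]).
  have Kgh := subgroupM Ksub Kg Kh.
  have Kgh' := subgroupM Ksub Kg (subgroupV Ksub Kh).
  by rewrite intrD intrM -!tE // SL2_trM.
- move=> g Kg; have [n gn] := finite_subgroup_order Ksub Kfin Kg.
  have [_] := SL2_finite_order_tr gn.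
  by rewrite tE // -intr_norm -[leRHS]/((2%:Z)%:~R)%R ler_int; lia.
- move=> g Kg; have [n gn] := finite_subgroup_order Ksub Kfin Kg.
  split=> [tg|g1]; first by apply: (SL2_finite_order_tr2 gn); rewrite tE // tg.
  by apply: (@intr_inj T[i]); rewrite -tE // g1 SL2_tr1.
- move=> g Kg tg; have [n gn] := finite_subgroup_order Ksub Kfin Kg.
  by apply: (SL2_finite_order_trN2 gn); rewrite tE // tg.
Qed.

Lemma presented_intro (P : forall H : groupType, seq H -> Prop) (G : groupType)
    (K : set G) (s : seq G) : is_subgroup K -> [set` s] `<=` K -> P G s ->
  (forall (H : groupType) (r : seq H), P H r ->
    exists f : G -> H, {in K &, {morph f : x y / x * y}} /\ map f s = r) ->
  presented P s.
Proof.
move=> Ksub sK Ps ext; split=> // H r Pr; have [f [fM fs]] := ext H r Pr.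
exists f; split=> // x y /set_mem Gx /set_mem Gy; apply: fM; apply/mem_set;
  exact: (subgroup_generated_min Ksub sK).
Qed.

Lemma morph_expg (G H : groupType) (K : set G) (f : G -> H) x n :
  is_subgroup K -> {in K &, {morph f : x y / x * y}} -> K x ->
  f (x ^+ n) = f x ^+ n.
Proof.
move=> Ksub fM Kx; elim: n => [|n IHn].
  have K1 : 1 \in K by exact/mem_set/(subgroup1 Ksub).
  by apply: (mulgI (f 1)); rewrite expg0 -fM // !mulg1.
rewrite !expgS fM ?IHn //; first exact: mem_set.
exact/mem_set/(subgroupX Ksub).
Qed.

(** Both the relations of Q8 and those of Q12 are instances, with z determined by
    the other entries. *)
Lemma dicyclic_presented (P : forall H : groupType, seq H -> Prop) n
    (G : groupType) (a b : G) : (1 < n)%N ->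
  (forall (H : groupType) (r : seq H), P H r <->
    exists c d, dicyclic_rel n c d /\ r = [:: d ^+ 2; d; c]) ->
  dicyclic_rel n a b -> has_order a n.*2 -> presented P [:: b ^+ 2; b; a].
Proof.
move=> n_gt1 PE ab_rel oa.
have Ksub := subgroup_generated_subgroup [set a; b].
have Ka : subgroup_generated [set a; b] a.
  by apply: subset_subgroup_generated; left.
have Kb : subgroup_generated [set a; b] b.
  by apply: subset_subgroup_generated; right.
apply: (presented_intro Ksub).
- move=> x /=; rewrite !inE => /or3P[] /eqP-> //; exact: (subgroupX Ksub).
- by apply/PE; exists a, b.
move=> H r /PE[c [d [cd_rel ->]]].
have [f [fM fa fb]] := dicyclic_morphism n_gt1 ab_rel oa cd_rel.
exists f; split=> //=; rewrite fa fb; congr [:: _; _; _].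
by rewrite (morph_expg _ Ksub fM Kb) fb.
Qed.

Lemma Q8_relationsE (H : groupType) (r : seq H) : Q8_relations r <->
  exists c d, dicyclic_rel 2 c d /\ r = [:: d ^+ 2; d; c].
Proof.
split=> [|[c [d [[dc cdc] ->]]]]; last by split.
case: r => [|z [|d [|c []]]] // [dz cz cdc]; exists c, d.
by split; [split; rewrite // dz cz|rewrite dz].
Qed.

Lemma Q12_relationsE (H : groupType) (r : seq H) : Q12_relations r <->
  exists c d, dicyclic_rel 3 c d /\ r = [:: d ^+ 2; d; c].
Proof.
split=> [|[c [d [[dc cdc] ->]]]]; last by split.
case: r => [|z [|d [|c []]]] // [dz cz cdc]; exists c, d.
by split; [split; rewrite // dz cz|rewrite dz].
Qed.

Lemma SL2F3_presented (G : groupType) (z x1 x2 x3 : G) :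
  SL2F3_relations [:: z; x1; x2; x3] -> z <> 1 ->
  presented SL2F3_relations [:: z; x1; x2; x3].
Proof.
move=> rel z1; have [[x1z _] _ _ _ _] := rel.
have Ksub := subgroup_generated_subgroup [set x1; x2; x3].
have K1 : subgroup_generated [set x1; x2; x3] x1.
  by apply: subset_subgroup_generated; left; left.
apply: (presented_intro Ksub) => //.
  move=> x /=; rewrite !inE => /or4P[] /eqP-> //.
  - by rewrite -x1z; exact: (subgroupX Ksub).
  - by apply: subset_subgroup_generated; left; right.
  - by apply: subset_subgroup_generated; right.
move=> H [|z' [|y1 [|y2 [|y3 []]]]] // rel'.
have [f [fM [f1 f2 f3]]] := tetrahedral_morphism rel z1 rel'.
exists f; split=> //=; rewrite f1 f2 f3; congr [:: _; _; _; _].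
have [[y1z _] _ _ _ _] := rel'.
by rewrite -x1z (morph_expg _ Ksub fM K1) f1 y1z.
Qed.

Theorem proposition24 (T : realType) (L : set T[i]) (HL : is_lattice L)
    (K : set (SL2 T[i])) (Ksub : is_subgroup K) (Kfin : finite_set K)
    (KR : K `<=` SL2_over (endomorphism_ring L)) :
  let SL2R := SL2_over (endomorphism_ring L) in
  let mI := SL2_opp1 T[i] in
  exists2 K' : set (SL2 T[i]), isomorphic K K' &
     K' = [set 1]
  \/ (K' = subgroup_generated [set mI] /\ isomorphic K' (@setT 'Z_2))
  \/ (exists g1, [/\ SL2R g1, (\tr g1 = 0)%R,
        K' = subgroup_generated [set g1] & isomorphic K' (@setT 'Z_4)])
  \/ (exists g1 g2, [/\ SL2R g1 /\ SL2R g2,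
        presented Q8_relations [:: mI; g1; g2],
        K' = subgroup_generated [set g1; g2] & isomorphic K' (@setT 'Q_8)])
  \/ (exists g3, [/\ SL2R g3, (\tr g3 = -1)%R,
        K' = subgroup_generated [set g3] & isomorphic K' (@setT 'Z_3)])
  \/ (exists g4, [/\ SL2R g4, (\tr g4 = 1)%R,
        K' = subgroup_generated [set g4] & isomorphic K' (@setT 'Z_6)])
  \/ (exists g1 g4, [/\ SL2R g1 /\ SL2R g4, (\tr g1 = 0 /\ \tr g4 = 1)%R,
        presented Q12_relations [:: mI; g1; g4],
        K' = subgroup_generated [set g1; g4]
      & exists (gT : finGroupType) (D : {group gT}),
          dicyclic 3 D /\ isomorphic K' [set` D]])
  \/ (exists g1 g2 g3, [/\ SL2R g1 /\ SL2R g2 /\ SL2R g3,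
        (\tr g1 = 0 /\ \tr g2 = 0 /\ \tr g3 = -1)%R,
        presented SL2F3_relations [:: mI; g1; g2; g3],
        K' = subgroup_generated [set g1; g2; g3]
      & isomorphic K' (@setT (SL2 'F_3))]).
Proof.
move=> SL2R mI.
have [t Kt tE] := finite_subgroup_integral_trace HL Ksub Kfin KR.
exists K; first exact: isomorphic_refl.
have RK g : K g -> SL2R g by exact: KR.
case: (integral_trace_classification Kt).
- by left.
- move=> Kz tz KE; right; left; split=> //; rewrite KE.
  exact: (@Zp_isomorphic _ _ 0 (traceN2_order Kt Kz tz)).
- move=> g Kg tg KE; do 2!right; left; exists g; split=> //.
  + exact: RK.
  + by rewrite tE // tg.
  + by rewrite KE; exact: (@Zp_isomorphic _ _ 2 (trace0_order Kt Kg tg)).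
- move=> a b Ka Kb ta tb tab KE; do 3!right; left; exists b, a.
  have oa := trace0_order Kt Ka ta.
  have [az _] := trace0_sqr Kt Ka ta; have [bz _] := trace0_sqr Kt Kb tb.
  have tba : t (b * a) = 0%R by rewrite (traceC Kt).
  have aba := trace0_braid Kt Kb Ka tb tba.
  have ab_rel : dicyclic_rel 2 a b by split=> //; rewrite bz az.
  split.
  + by split; exact: RK.
  + by rewrite /mI -bz; exact: (@dicyclic_presented _ 2 _ a b isT (@Q8_relationsE)).
  + by rewrite setUC.
  + by rewrite KE; apply: quaternion_isomorphic => //; rewrite -KE.
- move=> g Kg tg KE; do 4!right; left; exists g; split=> //.
  + exact: RK.
  + by rewrite tE // tg.
  + by rewrite KE; exact: (@Zp_isomorphic _ _ 1 (traceN1_order Kt Kg tg)).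
- move=> g Kg tg KE; do 5!right; left; exists g; split=> //.
  + exact: RK.
  + by rewrite tE // tg.
  + by rewrite KE; exact: (@Zp_isomorphic _ _ 4 (trace1_order Kt Kg tg)).
- move=> a b Ka Kb ta tb tab KE; do 6!right; left; exists b, a.
  have oa := trace1_order Kt Ka ta.
  have [az _] := trace1_cube Kt Ka ta; have [bz _] := trace0_sqr Kt Kb tb.
  have tba : t (b * a) = 0%R by rewrite (traceC Kt).
  have aba := trace0_braid Kt Kb Ka tb tba.
  have ab_rel : dicyclic_rel 3 a b by split=> //; rewrite bz az.
  have Kfin' : finite_set (subgroup_generated [set a; b]) by rewrite -KE.
  split.
  + by split; exact: RK.
  + by rewrite !tE // ta tb.
  + by rewrite /mI -bz; exact: (@dicyclic_presented _ 3 _ a b isT (@Q12_relationsE)).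
  + by rewrite setUC.
  + have [gT [c [d [cd_rel oc cdT]]]] := @dicyclic_model _ 3 _ _ isT ab_rel oa Kfin'.
    exists gT, [set: gT]%G; split; first exact: (@dicyclic_Grp _ 3 c d).
    rewrite (_ : [set` _] = setT); last by apply/seteqP; split=> x //=; rewrite inE.
    by rewrite KE -cdT; exact: (@dicyclic_isomorphic 3).
- move=> x1 x2 x3 K1 K2 K3 t1 t2 t3 t12 x31 x32 KE; do 7!right.
  have [x1z tz] := trace0_sqr Kt K1 t1; have [x2z _] := trace0_sqr Kt K2 t2.
  have Kz : K mI by rewrite /mI -x1z; exact: (subgroupX Ksub).
  have x33 : x3 ^+ 3 = 1 by apply/(traceN1_order Kt K3 t3).
  have x21 := trace0_anticommute Kt Kz tz K1 K2 t1 t2 t12.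
  have rel : SL2F3_relations [:: mI; x1; x2; x3] by [].
  have mI1 : mI <> 1 by move=> mI1; move: tz; rewrite -/mI mI1 (trace1 Kt).
  exists x1, x2, x3; split=> //.
  + by do !split; exact: RK.
  + by rewrite !tE // t1 t2 t3.
  + exact: SL2F3_presented.
  + rewrite KE -F3_generated.
    exact: (tetrahedral_isomorphic rel mI1 F3_relations F3_opp1_neq1).
Qed.
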